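(* Let $a>1$, $b>0$, $1<c<3/2$, $t_0>0$, $\mathring f>0$, $\mathring f_0>0$ be real constants. Consider the initial value problem $$f''(t)+\frac{a}{t}f'(t)-\frac{b}{t^2}f(t)(1+f(t))-\frac{c}{1+f(t)}(f'(t))^2=0,\qquad f(t_0)=\mathring f,\quad f'(t_0)=\mathring f_0, \qquad (\ast)$$ and write $f_0(t):=f'(t)$. With $\bar a,\bar c,\triangle,\mathtt A,\mathtt B,\mathtt C,\mathtt D,\mathtt E$, the set $\mathcal R$ and the times $t_\star,t^\star$ as defined in the context, the following hold. (1) $t_\star=\min\mathcal R\in[0,\infty)$ exists and $t_\star>t_0$. (2) There is $t_m\in[t_\star,\infty]$ such that there is a unique solution $f\in C^2([t_0,t_m))$ of $(\ast)$, and $$\lim_{t\to t_m}f(t)=+\infty,\qquad \lim_{t\to t_m}f_0(t)=+\infty.$$ (3) $f$ satisfies $$1+f(t)>\exp\bigl(\mathtt C\,t^{\frac{\bar a+\triangle}{2}}+\mathtt D\,t^{-1}\bigr)\quad\text{for } t\in(t_0,t_m),$$ $$1+f(t)<\bigl(\mathtt A\,t^{\frac{\bar a-\triangle}{2}}+\mathtt B\,t^{\frac{\bar a+\triangle}{2}}+1\bigr)^{-1}\quad\text{for } t\in(t_0,t_\star).$$ Furthermore, if in addition $\mathring f_0>\dfrac{\bar a(1+\mathring f)}{\bar c\,t_0}$, then: (4) both $t_\star$ and $t^\star$ exist and are finite, and $t_0<t_\star<t^\star<\infty$. (5) There is a finite time $t_m\in[t_\star,t^\star)$ such that there is a solution $f\in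 C^2([t_0,t_m))$ of $(\ast)$ with $\lim_{t\to t_m}f(t)=+\infty$ and $\lim_{t\to t_m}f_0(t)=+\infty$. (6) The solution $f$ satisfies, for $t\in(t_0,t_m)$, $$(1+\mathring f)\bigl(1-\mathtt E\,t_0^{\bar a}+\mathtt E\,t^{\bar a}\bigr)^{1/\bar c}<1+f(t).$$
   Context: Notation: $\bar a:=1-a<0$, $\bar c:=1-c<0$, $\triangle:=\sqrt{(1-a)^2+4b}>-\bar a$, and $$\mathtt A:=\frac{t_0^{-\frac{\bar a-\triangle}{2}}}{\triangle}\Bigl(\frac{t_0\mathring f_0}{(1+\mathring f)^2}-\frac{\bar a+\triangle}{2}\frac{\mathring f}{1+\mathring f}\Bigr),\qquad \mathtt B:=\frac{t_0^{-\frac{\bar a+\triangle}{2}}}{\triangle}\Bigl(\frac{\bar a-\triangle}{2}\frac{\mathring f}{1+\mathring f}-\frac{t_0\mathring f_0}{(1+\mathring f)^2}\Bigr)<0,$$ $$\mathtt C:=\frac{2}{2+\bar a+\triangle}\Bigl(\max\bigl\{\tfrac{\bar a+\triangle}{2b},1\bigr\}\Bigr)^{-1}\Bigl(\ln(1+\mathring f)+\frac{\bar a+\triangle}{2b}\frac{t_0\mathring f_0}{1+\mathring f}\Bigr)t_0^{-\frac{\bar a+\triangle}{2}}>0,$$ $$\mathtt D:=\frac{\bar a+\triangle}{2+\bar a+\triangle}\Bigl(\ln(1+\mathring f)-\frac1b\frac{t_0\mathring f_0}{1+\mathring f}\Bigr)t_0,\qquad \mathtt E:=\frac{\bar c\,\mathring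 f_0\,t_0^{1-\bar a}}{\bar a(1+\mathring f)}>0.$$ Critical times: $\mathcal R:=\{t_r>t_0 : \mathtt A t_r^{\frac{\bar a-\triangle}{2}}+\mathtt B t_r^{\frac{\bar a+\triangle}{2}}+1=0\}$; if $\mathcal R$ has a minimum, $t_\star:=\min\mathcal R$. If $t_0^{\bar a}>\mathtt E^{-1}$, then $t^\star:=(t_0^{\bar a}-\mathtt E^{-1})^{1/\bar a}\in(0,\infty)$, i.e. $t=t^\star$ solves $1-\mathtt E t_0^{\bar a}+\mathtt E t^{\bar a}=0$. *)

(* Defs.v *)
From Stdlib Require Import Reals.
From Coquelicot Require Import Coquelicot.
Open Scope R_scope.

(** In all definitions below, [u] and [v] are the initial data
    [u = f(t0)] and [v = f'(t0)].  Real powers are [Rpower x y = x^y]; they are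
    only meaningful for [x > 0]. *)

(** [bar a = 1 - a]; the same notation serves for [bar c]. *)
Definition bar (a : R) : R := 1 - a.

Definition tri (a b : R) : R := sqrt ((1 - a) ^ 2 + 4 * b).

Definition coefA (a b t0 u v : R) : R :=
  Rpower t0 (- ((bar a - tri a b) / 2)) / tri a b *
  (t0 * v / (1 + u) ^ 2 - (bar a + tri a b) / 2 * (u / (1 + u))).

Definition coefB (a b t0 u v : R) : R :=
  Rpower t0 (- ((bar a + tri a b) / 2)) / tri a b *
  ((bar a - tri a b) / 2 * (u / (1 + u)) - t0 * v / (1 + u) ^ 2).

Definition coefC (a b t0 u v : R) : R :=
  2 / (2 + bar a + tri a b) *
  / Rmax ((bar a + tri a b) / (2 * b)) 1 *
  (ln (1 + u) + (bar a + tri a b) / (2 * b) * (t0 * v / (1 + u))) *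
  Rpower t0 (- ((bar a + tri a b) / 2)).

Definition coefD (a b t0 u v : R) : R :=
  (bar a + tri a b) / (2 + bar a + tri a b) *
  (ln (1 + u) - 1 / b * (t0 * v / (1 + u))) * t0.

Definition coefE (a c t0 u v : R) : R :=
  bar c * v * Rpower t0 (1 - bar a) / (bar a * (1 + u)).

Definition upper_denominator (a b t0 u v t : R) : R :=
  coefA a b t0 u v * Rpower t ((bar a - tri a b) / 2) +
  coefB a b t0 u v * Rpower t ((bar a + tri a b) / 2) + 1.

Definition critical_set (a b t0 u v : R) : R -> Prop :=
  fun t => t0 < t /\ upper_denominator a b t0 u v t = 0.

Definition is_min (S : R -> Prop) (m : R) : Prop :=
  S m /\ forall t, S t -> m <= t.

Definition is_lower_star (a b t0 u v t : R) : Prop :=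
  is_min (critical_set a b t0 u v) t.

(** The upper critical time is only defined under the first condition, hence
    a relation: it has no value when [t0 ^ bar a <= / E]. *)
Definition is_upper_star (a c t0 u v t : R) : Prop :=
  / coefE a c t0 u v < Rpower t0 (bar a) /\
  t = Rpower (Rpower t0 (bar a) - / coefE a c t0 u v) (1 / bar a).

(** The interval [[t0, T)], with [T] possibly infinite. *)
Definition Ico (t0 : R) (T : Rbar) : R -> Prop :=
  fun t => t0 <= t /\ Rbar_lt t T.

(** Derivative relative to a set: one-sided at an endpoint that belongs to [S],
    the usual [is_derive] at interior points. *)
Definition is_derive_within (S : R -> Prop) (f : R -> R) (x l : R) : Prop :=
  filterdiff f (within S (locally x)) (fun h => scal h l).

(** [f] is C^2 on [S], with first and second derivatives [f1] and [f2] there. *)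
Definition C2_on (S : R -> Prop) (f f1 f2 : R -> R) : Prop :=
  (forall t, S t -> is_derive_within S f t (f1 t)) /\
  (forall t, S t -> is_derive_within S f1 t (f2 t)) /\
  continuous_on S f2.

(** [f] is a C^2 solution on [[t0, T)] of the initial value problem, and
    [f0 = f'].  The condition [1 + f t <> 0] says that the quotient in the
    equation is meaningful. *)
Definition is_solution (a b c t0 u v : R) (T : Rbar) (f f0 : R -> R) : Prop :=
  exists f00 : R -> R,
    C2_on (Ico t0 T) f f0 f00 /\
    (forall t, Ico t0 T t ->
       1 + f t <> 0 /\
       f00 t + a / t * f0 t - b / t ^ 2 * f t * (1 + f t)
         - c / (1 + f t) * (f0 t) ^ 2 = 0) /\
    f t0 = u /\ f0 t0 = v.

(** [f t -> +oo] as [t -> T] with [t < T]; [T] is finite or [+oo]. *)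
Definition tends_to_pinfty_at (f : R -> R) (T : Rbar) : Prop :=
  filterlim f (within (fun t => Rbar_lt t T) (Rbar_locally T))
    (Rbar_locally p_infty).

(* Main.v *)
(* Put [s = ln t], [w = ln (1 + f)] and [p = w_s = t f' / (1 + f)].  The equation
   becomes autonomous: [p_s = (1-a) p + b (e^w - 1) + (c-1) p^2].  Since [p] stays
   positive, it is a function [p = q(w)], where [r = q e^(-w/2)] solves
   [r' = (1-a) e^(-w/2) + (c-3/2) r + b (1 - e^(-w)) / r].  A small constant [eps]
   is a lower barrier for [r], so this field may be cut off at [r = eps] and is
   then globally Lipschitz: [q] exists for all [w >= w0] and [q >= eps e^(w/2)].
   The time at which [w] is reached, [t = t0 exp (int_w0^w 1/q)], is increasing
   and bounded; its inverse is the solution, which blows up at the supremum.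
   Any other solution satisfies [p - q(w) = 0], because this difference solves a
   linear homogeneous equation, hence has the same hitting times.

   The two-sided bounds compare [w] and [1 - e^(-w)], which are strict super- and
   subsolutions, with solutions of the Euler equation [y_ss = (1-a) y_s + b y].
   The last bound integrates the monotonicity of [t^a f' (1 + f)^(-c)]; since the
   gap it produces is bounded away from zero, blow-up occurs strictly before
   the upper critical time. *)

Require Import Defs.
From Stdlib Require Import Reals Lra Lia Ranalysis5.
From Coquelicot Require Import Coquelicot.
Open Scope R_scope.

(** * Global Picard iteration *)

(** Taking [w] as independent variable turns a blow-up problem into a global one: [q] lives on a
    half-line, and the divergence of [w] at the end time is built into the construction, so no
    continuation argument is needed. The weight [e^(w/2)] comes from the balance [q q' ~ b e^w] for
    large [w]; the competing rate [e^((c-1)w)] is slower because [c < 3/2]. Dividing by this weight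
    bounds the coefficients in [w], so that only [1/r] threatens the Lipschitz condition. It also
    makes [1/q] integrable up to infinity, which bounds the hitting times. For uniqueness the
    obstacle is that [q] is controlled only for [w >= w0], while nothing is assumed on the sign of
    [f'] for a rival solution; such a curve must be confined to [w >= w0] before it can be compared
    with [q]. *)

Lemma continuous_Rmax_l (k x : R) : continuous (fun x => Rmax k x) x.
Proof.
apply continuous_ext with (fun x => (k + x + Rabs (x - k)) * / 2).
  intros y; unfold Rmax, Rabs; destruct (Rle_dec k y), (Rcase_abs (y - k)); lra.
apply (continuous_mult (K := R_AbsRing)); [|apply continuous_const].
apply (continuous_plus (V := R_NormedModule)).
  apply (continuous_plus (V := R_NormedModule));
    [apply continuous_const | apply continuous_id].
apply continuous_comp; [|apply continuous_Rabs].
apply (continuous_minus (V := R_NormedModule));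
  [apply continuous_id | apply continuous_const].
Qed.

Lemma is_derive_continuous (f : R -> R) (x l : R) :
  is_derive f x l -> continuous f x.
Proof. intros h; apply (ex_derive_continuous (V := R_NormedModule)); now exists l. Qed.

Lemma continuous_eps (f : R -> R) (x : R) :
  continuous f x <->
  forall eps, 0 < eps ->
    exists d, 0 < d /\ forall y, Rabs (y - x) < d -> Rabs (f y - f x) < eps.
Proof.
split.
- intros h eps he.
  destruct (proj1 (filterlim_locally _ _) h (mkposreal eps he)) as [d hd].
  exists d; split; [apply cond_pos | intros y hy; apply (hd y hy)].
- intros h; apply filterlim_locally; intros eps.
  destruct (h eps (cond_pos eps)) as [d [hd hy]].
  exists (mkposreal d hd); intros y hb; apply (hy y hb).
Qed.

Lemma exp_monotone (x y : R) : x <= y -> exp x <= exp y.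
Proof. intros [h|h]; [now apply Rlt_le, exp_increasing | rewrite h; apply Rle_refl]. Qed.

Lemma lim_pow_half (C eps : R) : 0 <= C -> 0 < eps ->
  exists n, C * (/ 2) ^ n < eps.
Proof.
intros hC he.
destruct (pow_lt_1_zero (/ 2)) with (y := eps / (C + 1)) as [n hn].
- rewrite Rabs_pos_eq; lra.
- apply Rdiv_lt_0_compat; lra.
- exists n; specialize (hn n (le_n n)).
  rewrite Rabs_pos_eq in hn by (apply pow_le; lra).
  apply (Rmult_lt_compat_r (C + 1)) in hn; [|lra].
  replace (eps / (C + 1) * (C + 1)) with eps in hn by (field; lra).
  assert (0 < (/ 2) ^ n) by (apply pow_lt; lra); nra.
Qed.

(* Freezing [y] to the left of [x0] makes the iterates defined and continuous on
   the whole line, so that derivatives at [x0] are two-sided. *)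
Definition picard_step (H : R -> R -> R) (x0 y0 : R) (y : R -> R) (x : R) : R :=
  y0 + RInt (fun s => H s (y (Rmax x0 s))) x0 x.

Fixpoint picard_iter (H : R -> R -> R) (x0 y0 : R) (n : nat) : R -> R :=
  match n with
  | O => fun _ => y0
  | S n => picard_step H x0 y0 (picard_iter H x0 y0 n)
  end.

Definition lipschitz_field (H : R -> R -> R) (L : R) : Prop :=
  (forall y x, continuous (fun x => H x y) x) /\
  (forall x y z, Rabs (H x y - H x z) <= L * Rabs (y - z)).

(** Joint continuity is not assumed: splitting the increment at [H z (y (Rmax x0 x))] leaves a move
    in the second argument, controlled by the Lipschitz bound, and one in the first, controlled by
    continuity. *)
Lemma continuous_field (H : R -> R -> R) (L x0 : R) (y : R -> R) (x : R) :
  0 < L -> lipschitz_field H L -> (forall x, continuous y x) ->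
  continuous (fun s => H s (y (Rmax x0 s))) x.
Proof.
intros hL [hc hl] hy.
assert (hyc : continuous (fun s => y (Rmax x0 s)) x).
  apply continuous_comp; [apply continuous_Rmax_l | apply hy].
apply continuous_eps; intros eps he.
destruct (proj1 (continuous_eps _ _) (hc (y (Rmax x0 x)) x) (eps / 2)) as [d1 [h1 h1']].
  lra.
destruct (proj1 (continuous_eps _ _) hyc (eps / 2 / L)) as [d2 [h2 h2']].
  repeat apply Rdiv_lt_0_compat; lra.
exists (Rmin d1 d2); split; [now apply Rmin_glb_lt|].
intros z hz.
specialize (h1' z (Rlt_le_trans _ _ _ hz (Rmin_l _ _))).
specialize (h2' z (Rlt_le_trans _ _ _ hz (Rmin_r _ _))).
specialize (hl z (y (Rmax x0 z)) (y (Rmax x0 x))).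
apply (Rmult_lt_compat_l L) in h2'; [|lra].
replace (L * (eps / 2 / L)) with (eps / 2) in h2' by (field; lra).
replace (H z (y (Rmax x0 z)) - H x (y (Rmax x0 x)))
  with (H z (y (Rmax x0 z)) - H z (y (Rmax x0 x))
        + (H z (y (Rmax x0 x)) - H x (y (Rmax x0 x)))) by ring.
eapply Rle_lt_trans; [apply Rabs_triang | lra].
Qed.

Lemma is_derive_RInt_const (h : R -> R) (x0 y0 x : R) :
  (forall x, continuous h x) ->
  is_derive (fun x => y0 + RInt h x0 x) x (h x).
Proof.
intros hc.
replace (h x) with (plus zero (h x)) by apply (plus_zero_l (h x)).
apply (is_derive_plus (V := R_NormedModule)); [apply (is_derive_const (V := R_NormedModule))|].
apply (is_derive_RInt h _ x0).
- apply filter_forall; intros z; apply (RInt_correct h).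
  now apply (ex_RInt_continuous h).
- apply hc.
Qed.

Lemma picard_step_derive (H : R -> R -> R) (L x0 y0 : R) (y : R -> R) (x : R) :
  0 < L -> lipschitz_field H L -> (forall x, continuous y x) ->
  is_derive (picard_step H x0 y0 y) x (H x (y (Rmax x0 x))).
Proof.
intros hL hH hy.
apply (is_derive_RInt_const (fun s => H s (y (Rmax x0 s)))).
intros z; now apply continuous_field with L.
Qed.

Lemma RInt_exp (k x0 x : R) : k <> 0 ->
  is_RInt (fun s => exp (k * (s - x0))) x0 x ((exp (k * (x - x0)) - 1) / k).
Proof.
intros hk.
replace ((exp (k * (x - x0)) - 1) / k)
  with (minus (exp (k * (x - x0)) / k) (exp (k * (x0 - x0)) / k)).
- apply (is_RInt_derive (fun s => exp (k * (s - x0)) / k)).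
  + intros s _; auto_derive; [trivial | unfold Rminus; field; trivial].
  + intros s _; apply (ex_derive_continuous (V := R_NormedModule)); auto_derive; trivial.
- unfold minus, plus, opp; simpl.
  replace (k * (x0 - x0)) with 0 by ring; rewrite exp_0; field; trivial.
Qed.

(* In the norm weighted by [exp (2 L (x - x0))] the Picard operator halves
   distances, whatever the length of the interval. *)
Lemma picard_step_contract (H : R -> R -> R) (L x0 y0 D : R) (y z : R -> R) :
  0 < L -> lipschitz_field H L ->
  (forall x, continuous y x) -> (forall x, continuous z x) ->
  0 <= D ->
  (forall x, x0 <= x -> Rabs (y x - z x) <= D * exp (2 * L * (x - x0))) ->
  forall x, x0 <= x ->
    Rabs (picard_step H x0 y0 y x - picard_step H x0 y0 z x)
      <= D / 2 * exp (2 * L * (x - x0)).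
Proof.
intros hL hH hy hz hD hd x hx.
pose (h := fun s => H s (y (Rmax x0 s)) - H s (z (Rmax x0 s))).
assert (ey : ex_RInt (fun s => H s (y (Rmax x0 s))) x0 x).
  apply (ex_RInt_continuous (fun s => H s (y (Rmax x0 s)))).
  intros; now apply continuous_field with L.
assert (ez : ex_RInt (fun s => H s (z (Rmax x0 s))) x0 x).
  apply (ex_RInt_continuous (fun s => H s (z (Rmax x0 s)))).
  intros; now apply continuous_field with L.
assert (eh : ex_RInt h x0 x).
  apply (ex_RInt_minus (V := R_NormedModule)); assumption.
assert (heq : picard_step H x0 y0 y x - picard_step H x0 y0 z x = RInt h x0 x).
  unfold picard_step, h.
  rewrite (RInt_minus (fun s => H s (y (Rmax x0 s))) (fun s => H s (z (Rmax x0 s))))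
    by assumption.
  unfold minus, plus, opp; simpl; ring.
rewrite heq.
assert (hI := is_RInt_scal _ _ _ (L * D) _ (RInt_exp (2 * L) x0 x ltac:(lra))).
eapply Rle_trans; [apply abs_RInt_le; trivial|].
eapply Rle_trans.
- apply RInt_le with (g := fun s => L * D * exp (2 * L * (s - x0))); trivial.
  + apply ex_RInt_norm; trivial.
  + eexists; apply hI.
  + intros s hs; unfold h.
    eapply Rle_trans; [apply (proj2 hH)|].
    rewrite Rmax_right by lra.
    rewrite Rmult_assoc; apply Rmult_le_compat_l; [lra | apply hd; lra].
- erewrite (is_RInt_unique (fun s => L * D * exp (2 * L * (s - x0)))); [|apply hI].
  unfold scal; simpl; unfold mult; simpl.
  replace (L * D * ((exp (2 * L * (x - x0)) - 1) / (2 * L)))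
    with (D / 2 * (exp (2 * L * (x - x0)) - 1)) by (field; lra).
  nra.
Qed.

Lemma picard_iter_continuous (H : R -> R -> R) (L x0 y0 : R) (n : nat) (x : R) :
  0 < L -> lipschitz_field H L -> continuous (picard_iter H x0 y0 n) x.
Proof.
intros hL hH; revert x; induction n as [|n IH]; intros x.
- apply continuous_const.
- eapply is_derive_continuous, picard_step_derive; eassumption.
Qed.

(** The first increment is at most [M * (x - x0)], which [1 + s <= exp s] bounds by [M / (2 * L)]
    times the weight; contraction then halves the constant at each step. *)
Lemma picard_iter_diff (H : R -> R -> R) (L M x0 y0 : R) (n : nat) :
  0 < L -> lipschitz_field H L ->
  (forall x, x0 <= x -> Rabs (H x y0) <= M) ->
  forall x, x0 <= x ->
    Rabs (picard_iter H x0 y0 (S n) x - picard_iter H x0 y0 n x)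
      <= M / (2 * L) * (/ 2) ^ n * exp (2 * L * (x - x0)).
Proof.
intros hL hH hM.
assert (hM0 : 0 <= M) by (eapply Rle_trans; [apply Rabs_pos | apply (hM x0); lra]).
assert (hML : 0 <= M / (2 * L)) by (apply Rdiv_le_0_compat; lra).
induction n as [|n IH]; intros x hx.
- simpl; unfold picard_step.
  rewrite Rplus_minus_l.
  eapply Rle_trans.
  + apply (abs_RInt_le_const _ _ _ M); trivial.
    * apply (ex_RInt_continuous (fun s => H s y0)); intros; apply (proj1 hH).
    * intros t ht; apply hM; lra.
  + replace ((x - x0) * M) with (M / (2 * L) * 1 * (2 * L * (x - x0))) by (field; lra).
    apply Rmult_le_compat_l; [lra|].
    generalize (exp_ineq1_le (2 * L * (x - x0))); lra.
- replace (M / (2 * L) * (/ 2) ^ S n) with (M / (2 * L) * (/ 2) ^ n / 2) by (simpl; field; lra).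
  change (picard_iter H x0 y0 (S (S n)) x)
    with (picard_step H x0 y0 (picard_iter H x0 y0 (S n)) x).
  change (picard_iter H x0 y0 (S n) x)
    with (picard_step H x0 y0 (picard_iter H x0 y0 n) x).
  apply picard_step_contract; trivial.
  + intros; now apply picard_iter_continuous with L.
  + intros; now apply picard_iter_continuous with L.
  + apply Rmult_le_pos; [trivial | apply pow_le; lra].
Qed.

(** Telescoping; keeping the exact difference of powers lets the induction on [k] close with
    equality. *)
Lemma picard_iter_tail (H : R -> R -> R) (L M x0 y0 : R) (n k : nat) :
  0 < L -> lipschitz_field H L ->
  (forall x, x0 <= x -> Rabs (H x y0) <= M) ->
  forall x, x0 <= x ->
    Rabs (picard_iter H x0 y0 (n + k) x - picard_iter H x0 y0 n x)
      <= M / L * ((/ 2) ^ n - (/ 2) ^ (n + k)) * exp (2 * L * (x - x0)).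
Proof.
intros hL hH hM x hx; induction k as [|k IH].
- rewrite Nat.add_0_r, 2!Rminus_diag, Rabs_R0; lra.
- rewrite Nat.add_succ_r.
  assert (hd := picard_iter_diff H L M x0 y0 (n + k) hL hH hM x hx).
  replace (picard_iter H x0 y0 (S (n + k)) x - picard_iter H x0 y0 n x)
    with (picard_iter H x0 y0 (S (n + k)) x - picard_iter H x0 y0 (n + k) x
          + (picard_iter H x0 y0 (n + k) x - picard_iter H x0 y0 n x)) by ring.
  eapply Rle_trans; [apply Rabs_triang|].
  eapply Rle_trans; [apply Rplus_le_compat; eassumption|].
  apply Req_le; simpl; field; lra.
Qed.

(** The rate is locally uniform in [x]; both the continuity of the limit and the fixed-point
    identity are read off from it. *)
Lemma picard_limit (H : R -> R -> R) (L M x0 y0 : R) :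
  0 < L -> lipschitz_field H L ->
  (forall x, x0 <= x -> Rabs (H x y0) <= M) ->
  exists yl : R -> R, forall n x, x0 <= x ->
    Rabs (yl x - picard_iter H x0 y0 n x) <= M / L * (/ 2) ^ n * exp (2 * L * (x - x0)).
Proof.
intros hL hH hM.
assert (hM0 : 0 <= M) by (eapply Rle_trans; [apply Rabs_pos | apply (hM x0); lra]).
assert (hML : 0 <= M / L) by (apply Rdiv_le_0_compat; lra).
exists (fun x => real (Lim_seq (fun n => picard_iter H x0 y0 n x))).
intros n x hx.
assert (hexp := exp_pos (2 * L * (x - x0))).
assert (htail : forall n k, Rabs (picard_iter H x0 y0 (n + k) x - picard_iter H x0 y0 n x)
      <= M / L * exp (2 * L * (x - x0)) * (/ 2) ^ n).
  intros m k; eapply Rle_trans; [exact (picard_iter_tail H L M x0 y0 m k hL hH hM x hx)|].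
  replace (M / L * exp (2 * L * (x - x0)) * (/ 2) ^ m)
    with (M / L * (/ 2) ^ m * exp (2 * L * (x - x0))) by ring.
  apply Rmult_le_compat_r; [lra|]; apply Rmult_le_compat_l; [lra|].
  assert (0 < (/ 2) ^ (m + k)) by (apply pow_lt; lra); lra.
assert (hex : ex_finite_lim_seq (fun n => picard_iter H x0 y0 n x)).
  apply ex_lim_seq_cauchy_corr; intros eps.
  destruct (lim_pow_half (M / L * exp (2 * L * (x - x0))) (eps / 2)) as [N hN].
  - apply Rmult_le_pos; lra.
  - generalize (cond_pos eps); lra.
  - exists N; intros p q hp hq.
    assert (h1 := htail N (p - N)%nat); assert (h2 := htail N (q - N)%nat).
    replace (N + (p - N))%nat with p in h1 by lia.
    replace (N + (q - N))%nat with q in h2 by lia.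
    apply Rabs_def1; apply Rabs_le_between in h1; apply Rabs_le_between in h2; lra.
destruct hex as [l hl].
rewrite (is_lim_seq_unique _ _ hl); simpl.
replace (M / L * (/ 2) ^ n * exp (2 * L * (x - x0)))
  with (M / L * exp (2 * L * (x - x0)) * (/ 2) ^ n) by ring.
apply (is_lim_seq_incr_n _ n) in hl.
assert (h : is_lim_seq (fun k => Rabs (picard_iter H x0 y0 (k + n) x - picard_iter H x0 y0 n x))
          (Rabs (l - picard_iter H x0 y0 n x))).
  apply (is_lim_seq_abs _ (Finite (l - picard_iter H x0 y0 n x))).
  apply is_lim_seq_minus'; [assumption | apply is_lim_seq_const].
eapply (is_lim_seq_le _ _ (Finite _) (Finite _) _ h (is_lim_seq_const _)).
Unshelve.
intros k; simpl; rewrite Nat.add_comm; apply htail.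
Qed.

Theorem picard_lindelof (H : R -> R -> R) (L M x0 y0 : R) :
  0 < L -> lipschitz_field H L ->
  (forall x, x0 <= x -> Rabs (H x y0) <= M) ->
  exists y : R -> R, y x0 = y0 /\
    forall x, is_derive y x (H x (y (Rmax x0 x))).
Proof.
intros hL hH hM.
assert (hM0 : 0 <= M) by (eapply Rle_trans; [apply Rabs_pos | apply (hM x0); lra]).
assert (hML : 0 <= M / L) by (apply Rdiv_le_0_compat; lra).
destruct (picard_limit H L M x0 y0 hL hH hM) as [yl hyl].
pose (z := fun x => yl (Rmax x0 x)).
assert (hz : forall x, continuous z x).
  intros x; apply continuous_eps; intros eps he.
  (* [K] bounds the error constant everywhere to the left of [x + 1], so one [n] serves a whole
     neighbourhood. *)
  pose (K := M / L * exp (2 * L * (Rmax x0 (x + 1) - x0))).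
  destruct (lim_pow_half K (eps / 3)) as [n hn].
  - apply Rmult_le_pos; [lra | apply Rlt_le, exp_pos].
  - lra.
  - assert (hc : continuous (fun x => picard_iter H x0 y0 n (Rmax x0 x)) x).
      apply continuous_comp; [apply continuous_Rmax_l|].
      now apply picard_iter_continuous with L.
    destruct (proj1 (continuous_eps _ _) hc (eps / 3)) as [d [hd hd']]; [lra|].
    exists (Rmin d 1); split; [apply Rmin_glb_lt; lra|].
    intros t ht.
    specialize (hd' t (Rlt_le_trans _ _ _ ht (Rmin_l _ _))).
    assert (ht1 := Rlt_le_trans _ _ _ ht (Rmin_r _ _)).
    assert (hle : forall s, s <= x + 1 ->
       Rabs (z s - picard_iter H x0 y0 n (Rmax x0 s)) < eps / 3).
      intros s hs; eapply Rle_lt_trans; [apply (hyl n (Rmax x0 s)), Rmax_l|].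
      eapply Rle_lt_trans; [|apply hn].
      unfold K; rewrite (Rmult_assoc _ (exp _)), (Rmult_comm (exp _)), <- Rmult_assoc.
      apply Rmult_le_compat_l; [apply Rmult_le_pos; [lra | apply pow_le; lra]|].
      apply exp_monotone.
      apply Rmult_le_compat_l; [lra|].
      assert (Rmax x0 s <= Rmax x0 (x + 1)) by (apply Rle_max_compat_l; lra); lra.
    apply Rabs_def2 in ht1.
    assert (h1 := hle t ltac:(lra)); assert (h2 := hle x ltac:(lra)).
    apply Rabs_def2 in h1; apply Rabs_def2 in h2; apply Rabs_def2 in hd'.
    apply Rabs_def1; lra.
exists (picard_step H x0 y0 z); split.
  unfold picard_step; rewrite RInt_point; unfold zero; simpl; ring.
assert (heq : forall x, x0 <= x -> picard_step H x0 y0 z x = z x).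
  intros x hx.
  (* Both sides are close to iterate [n + 1]: the step of [z] by contraction, [z] by the rate of
     convergence. Each error is half of [M / L * (/ 2) ^ n] times the weight, for every [n]. *)
  destruct (Req_dec (picard_step H x0 y0 z x) (z x)) as [e|ne]; [trivial|exfalso].
  assert (hexp := exp_pos (2 * L * (x - x0))).
  destruct (lim_pow_half (M / L * exp (2 * L * (x - x0)))
              (Rabs (picard_step H x0 y0 z x - z x))) as [n hn].
  - apply Rmult_le_pos; lra.
  - apply Rabs_pos_lt; lra.
  - assert (h1 := picard_step_contract H L x0 y0 (M / L * (/ 2) ^ n) z
      (picard_iter H x0 y0 n) hL hH hz
      (fun x => picard_iter_continuous H L x0 y0 n x hL hH)).
    assert (hx1 : 0 <= M / L * (/ 2) ^ n)
      by (apply Rmult_le_pos; [lra | apply pow_le; lra]).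
    specialize (h1 hx1).
    assert (hx2 : forall x, x0 <= x -> Rabs (z x - picard_iter H x0 y0 n x) <=
       M / L * (/ 2) ^ n * exp (2 * L * (x - x0))).
      intros s hs; unfold z; rewrite Rmax_right by trivial; now apply hyl.
    specialize (h1 hx2 x hx).
    assert (h2 := hyl (S n) x hx).
    replace (yl x) with (z x) in h2 by (unfold z; now rewrite Rmax_right).
    change (picard_iter H x0 y0 (S n) x)
      with (picard_step H x0 y0 (picard_iter H x0 y0 n) x) in h2.
    simpl in h2.
    apply (Rlt_irrefl (Rabs (picard_step H x0 y0 z x - z x))).
    eapply Rle_lt_trans; [|apply hn].
    replace (picard_step H x0 y0 z x - z x)
      with (picard_step H x0 y0 z x - picard_step H x0 y0 (picard_iter H x0 y0 n) x
            - (z x - picard_step H x0 y0 (picard_iter H x0 y0 n) x)) by ring.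
    eapply Rle_trans; [apply Rabs_triang|]; rewrite Rabs_Ropp.
    eapply Rle_trans; [apply Rplus_le_compat; eassumption|].
    apply Req_le; field; lra.
intros x.
replace (picard_step H x0 y0 z (Rmax x0 x)) with (z (Rmax x0 x))
  by (symmetry; apply heq, Rmax_l).
replace (z (Rmax x0 x)) with (yl (Rmax x0 x))
  by (unfold z; rewrite (Rmax_right x0 (Rmax x0 x)); [trivial | apply Rmax_l]).
replace (yl (Rmax x0 x)) with (z (Rmax x0 x))
  by (unfold z; rewrite (Rmax_right x0 (Rmax x0 x)); [trivial | apply Rmax_l]).
now apply picard_step_derive with L.
Qed.

(** * The phase curve *)

Lemma is_derive_eq (f : R -> R) (x l l' : R) :
  is_derive f x l' -> l' = l -> is_derive f x l.
Proof. now intros h <-. Qed.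

Lemma mean_value (f df : R -> R) (x y : R) :
  x < y ->
  (forall t, x <= t <= y -> continuous f t) ->
  (forall t, x < t < y -> is_derive f t (df t)) ->
  exists t, x < t < y /\ f y - f x = df t * (y - x).
Proof.
intros hxy hc hd.
assert (pr1 : forall t, x < t < y -> derivable_pt f t).
  intros t ht; apply ex_derive_Reals_0; exists (df t); now apply hd.
assert (pr2 : forall t, x < t < y -> derivable_pt id t).
  intros; apply derivable_pt_id.
destruct (MVT f id x y pr1 pr2 hxy) as [t [ht e]].
- intros t ht; apply continuity_pt_filterlim, (hc t ht).
- intros; apply derivable_continuous_pt, derivable_pt_id.
- exists t; split; [trivial|].
  rewrite Derive_Reals, Derive_Reals in e.
  rewrite (is_derive_unique f t (df t) (hd t ht)) in e.
  replace (Derive id t) with 1 in e by (symmetry; apply Derive_id).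
  unfold id in e; lra.
Qed.

Lemma increasing_of_derive (f df : R -> R) (x y : R) :
  x < y ->
  (forall t, x <= t <= y -> continuous f t) ->
  (forall t, x < t < y -> is_derive f t (df t)) ->
  (forall t, x < t < y -> 0 < df t) -> f x < f y.
Proof.
intros hxy hc hd hp.
destruct (mean_value f df x y hxy hc hd) as [t [ht e]].
specialize (hp t ht).
assert (0 < df t * (y - x)) by (apply Rmult_lt_0_compat; lra); lra.
Qed.

Lemma nondecreasing_of_derive (f df : R -> R) (x y : R) :
  x <= y ->
  (forall t, x <= t <= y -> continuous f t) ->
  (forall t, x < t < y -> is_derive f t (df t)) ->
  (forall t, x < t < y -> 0 <= df t) -> f x <= f y.
Proof.
intros [hxy|hxy] hc hd hp; [|rewrite hxy; lra].
destruct (mean_value f df x y hxy hc hd) as [t [ht e]].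
specialize (hp t ht).
assert (0 <= df t * (y - x)) by (apply Rmult_le_pos; lra); lra.
Qed.

Lemma continuous_pos_near (f : R -> R) (x : R) :
  continuous f x -> 0 < f x ->
  exists d, 0 < d /\ forall y, Rabs (y - x) < d -> 0 < f y.
Proof.
intros hc hp.
destruct (proj1 (continuous_eps f x) hc (f x) hp) as [d [hd h]].
exists d; split; [trivial | intros y hy].
specialize (h y hy); apply Rabs_def2 in h; lra.
Qed.

Lemma is_derive_pos_near (f : R -> R) (x l : R) :
  is_derive f x l -> 0 < l ->
  exists d, 0 < d /\ forall h, 0 < h < d -> f (x - h) < f x < f (x + h).
Proof.
intros hd hl.
apply is_derive_Reals in hd.
destruct (hd l hl) as [e he].
exists e; split; [apply cond_pos | intros h hh].
assert (hr := he h ltac:(lra)); rewrite Rabs_pos_eq in hr by lra.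
assert (hq := he (- h) ltac:(lra)); rewrite Rabs_Ropp, Rabs_pos_eq in hq by lra.
specialize (hr (proj2 hh)); specialize (hq (proj2 hh)).
apply Rabs_def2 in hr; apply Rabs_def2 in hq.
assert (hr' : 0 < (f (x + h) - f x) / h * h) by (apply Rmult_lt_0_compat; lra).
assert (hq' : 0 < (f (x + - h) - f x) / - h * h) by (apply Rmult_lt_0_compat; lra).
replace ((f (x + h) - f x) / h * h) with (f (x + h) - f x) in hr' by (field; lra).
replace ((f (x + - h) - f x) / - h * h) with (f x - f (x - h)) in hq'
  by (unfold Rminus; field; lra).
lra.
Qed.

(** A value below [eps] would put the minimum of [f] on [[x0, x]] below [eps] and away from [x0];
    there [df] is positive, so [f] is smaller just to the left. *)
Lemma lower_barrier (f df : R -> R) (x0 eps : R) :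
  (forall x, x0 <= x -> is_derive f x (df x)) ->
  eps <= f x0 ->
  (forall x, x0 <= x -> f x <= eps -> 0 < df x) ->
  forall x, x0 <= x -> eps <= f x.
Proof.
intros hd h0 hp x hx.
apply Rnot_lt_le; intros hlt.
destruct (continuity_ab_min f x0 x hx) as [m [hmin hm]].
  intros t ht; apply continuity_pt_filterlim.
  eapply is_derive_continuous, hd; lra.
assert (hfm := hmin x ltac:(lra)).
assert (hne : m <> x0) by (intros ->; lra).
destruct (is_derive_pos_near f m (df m)) as [d [hd0 hdm]].
- apply hd; lra.
- apply hp; lra.
- pose (h := Rmin (d / 2) (m - x0)).
  assert (0 < h) by (apply Rmin_glb_lt; lra).
  assert (h <= d / 2) by apply Rmin_l; assert (h <= m - x0) by apply Rmin_r.
  specialize (hdm h ltac:(lra)); specialize (hmin (m - h) ltac:(lra)); lra.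
Qed.

Lemma Rmax_lipschitz (k y z : R) : Rabs (Rmax k y - Rmax k z) <= Rabs (y - z).
Proof.
unfold Rmax, Rabs; destruct (Rle_dec k y), (Rle_dec k z);
  repeat destruct (Rcase_abs _); lra.
Qed.

Lemma Rinv_lipschitz (eps y z : R) : 0 < eps -> eps <= y -> eps <= z ->
  Rabs (/ y - / z) <= / eps ^ 2 * Rabs (y - z).
Proof.
intros he hy hz.
replace (/ y - / z) with (/ (y * z) * (z - y)) by (field; lra).
rewrite Rabs_mult, (Rabs_minus_sym z y), Rabs_pos_eq.
- apply Rmult_le_compat_r; [apply Rabs_pos|].
  apply Rinv_le_contravar; [apply pow_lt; lra | nra].
- apply Rlt_le, Rinv_0_lt_compat; nra.
Qed.

(* The field of the equation for [r = q exp (- w / 2)]; the cut-off [Rmax eps]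
   is never active since [eps] turns out to be a lower barrier. *)
Definition phase_field (a b c eps w0 w r : R) : R :=
  (1 - a) * exp (- Rmax w0 w / 2) + (c - 3 / 2) * r
  + b * (1 - exp (- Rmax w0 w)) * / Rmax eps r.

Lemma exp_neg_bounds (w : R) : 0 < w -> 0 < exp (- w) < 1.
Proof.
intros hw; split; [apply exp_pos | rewrite <- exp_0; apply exp_increasing; lra].
Qed.

(** The [1] absorbs [Rabs (c - 3 / 2)]; [b * / eps ^ 2] is the Lipschitz constant of [b / r] on
    [r >= eps], since [1 - exp (- w)] lies in [[0, 1]]. *)
Lemma phase_field_lipschitz (a b c eps w0 : R) :
  0 < b -> 1 < c < 3 / 2 -> 0 < w0 -> 0 < eps ->
  lipschitz_field (phase_field a b c eps w0) (1 + b * / eps ^ 2).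
Proof.
intros hb hc hw he; split.
- intros y x; unfold phase_field.
  apply (continuous_comp (fun x => Rmax w0 x) (fun m =>
    (1 - a) * exp (- m / 2) + (c - 3 / 2) * y + b * (1 - exp (- m)) * / Rmax eps y)).
  + apply continuous_Rmax_l.
  + apply (ex_derive_continuous (V := R_NormedModule)); auto_derive; trivial.
- intros x y z; unfold phase_field.
  assert (hm := Rmax_l w0 x); assert (hx := exp_neg_bounds (Rmax w0 x) ltac:(lra)).
  set (k := 1 - exp (- Rmax w0 x)).
  assert (hk : 0 <= k <= 1) by (unfold k; lra).
  match goal with |- Rabs ?e <= _ =>
    replace e with ((c - 3 / 2) * (y - z) + b * k * (/ Rmax eps y - / Rmax eps z)) by ring
  end.
  eapply Rle_trans; [apply Rabs_triang|].
  rewrite !Rabs_mult, (Rabs_pos_eq b), (Rabs_pos_eq k) by lra.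
  assert (h1 := Rinv_lipschitz eps _ _ he (Rmax_l eps y) (Rmax_l eps z)).
  assert (h2 := Rmax_lipschitz eps y z).
  assert (h3 : Rabs (c - 3 / 2) <= 1) by (apply Rabs_le; lra).
  assert (h4 := Rabs_pos (y - z)).
  assert (h5 : 0 < / eps ^ 2) by (apply Rinv_0_lt_compat, pow_lt; lra).
  assert (h6 := Rabs_pos (/ Rmax eps y - / Rmax eps z)).
  assert (h7 : Rabs (/ Rmax eps y - / Rmax eps z) <= / eps ^ 2 * Rabs (y - z)).
    eapply Rle_trans; [apply h1 | apply Rmult_le_compat_l; lra].
  assert (h8 : b * k * Rabs (/ Rmax eps y - / Rmax eps z)
            <= b * (/ eps ^ 2 * Rabs (y - z))).
    apply Rmult_le_compat; [nra | lra | nra | lra].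
  assert (h9 : Rabs (c - 3 / 2) * Rabs (y - z) <= 1 * Rabs (y - z))
    by (apply Rmult_le_compat_r; lra).
  lra.
Qed.

Lemma phase_field_bounded (a b c eps w0 r : R) :
  0 < b -> 0 < w0 -> 0 < eps ->
  forall w, Rabs (phase_field a b c eps w0 w r)
    <= Rabs (1 - a) + Rabs ((c - 3 / 2) * r) + b * / eps.
Proof.
intros hb hw he w; unfold phase_field.
assert (hm := Rmax_l w0 w); assert (hx := exp_neg_bounds (Rmax w0 w) ltac:(lra)).
assert (hx2 := exp_neg_bounds (Rmax w0 w / 2) ltac:(lra)).
replace (- (Rmax w0 w / 2)) with (- Rmax w0 w / 2) in hx2 by field.
assert (hr := Rmax_l eps r).
assert (hi : 0 < / Rmax eps r <= / eps).
  split; [apply Rinv_0_lt_compat; lra | apply Rinv_le_contravar; lra].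
eapply Rle_trans; [apply Rabs_triang|]; apply Rplus_le_compat.
- eapply Rle_trans; [apply Rabs_triang|]; apply Rplus_le_compat; [|lra].
  rewrite Rabs_mult, (Rabs_pos_eq (exp _)) by lra.
  generalize (Rabs_pos (1 - a)); nra.
- rewrite Rabs_pos_eq.
  + apply Rmult_le_compat; nra.
  + apply Rmult_le_pos; nra.
Qed.

(** The equation for [q] is the quotient [p_s / w_s] along [p = q(w)]. *)
Lemma phase_curve (a b c w0 p0 : R) :
  1 < a -> 0 < b -> 1 < c < 3 / 2 -> 0 < w0 -> 0 < p0 ->
  exists (eps : R) (q : R -> R), 0 < eps /\ q w0 = p0 /\
    (forall w, w0 <= w -> eps * exp (w / 2) <= q w) /\
    (forall w, w0 <= w ->
      is_derive q w ((1 - a) + (c - 1) * q w + b * (exp w - 1) * / q w)).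
Proof.
intros ha hb hc hw hp.
assert (hk := exp_neg_bounds w0 hw).
pose (r0 := p0 * exp (- (w0 / 2))).
assert (hr0 : 0 < r0) by (apply Rmult_lt_0_compat; [lra | apply exp_pos]).
(* For [w >= w0] and [r <= eps <= e1] the source [b * (1 - exp (- w)) / eps] is at least [a]. This
   outweighs [(1 - a) * exp (- w / 2) > 1 - a] together with [(c - 3 / 2) * r > - 1 / 2], the latter
   because [eps <= 1]. *)
pose (e1 := b * (1 - exp (- w0)) / a).
assert (he1 : 0 < e1) by (apply Rdiv_lt_0_compat; nra).
pose (eps := Rmin 1 (Rmin r0 e1)).
assert (he : 0 < eps) by (repeat apply Rmin_glb_lt; lra).
assert (hle1 : eps <= 1) by apply Rmin_l.
assert (hler : eps <= r0) by (eapply Rle_trans; [apply Rmin_r | apply Rmin_l]).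
assert (hlee : eps <= e1) by (eapply Rle_trans; [apply Rmin_r | apply Rmin_r]).
assert (hL : 0 < 1 + b * / eps ^ 2).
  assert (0 < / eps ^ 2) by (apply Rinv_0_lt_compat, pow_lt; lra); nra.
destruct (picard_lindelof (phase_field a b c eps w0) (1 + b * / eps ^ 2)
  (Rabs (1 - a) + Rabs ((c - 3 / 2) * r0) + b * / eps) w0 r0) as [r [hrw hrd]].
- exact hL.
- now apply phase_field_lipschitz.
- intros; now apply phase_field_bounded.
- assert (hrd' : forall w, w0 <= w -> is_derive r w (phase_field a b c eps w0 w (r w))).
    intros w h; specialize (hrd w); rewrite (Rmax_right w0 w h) in hrd; exact hrd.
  assert (hbar : forall w, w0 <= w -> eps <= r w).
    apply (lower_barrier r _ w0 eps hrd'); [lra|].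
    intros w h hrle; unfold phase_field.
    rewrite (Rmax_right w0 w h), (Rmax_left eps (r w) hrle).
    assert (h1 : exp (- w / 2) < 1) by
      (rewrite <- exp_0; apply exp_increasing; lra).
    assert (h2 : exp (- w) <= exp (- w0)) by (apply exp_monotone; lra).
    assert (h3 : a <= b * (1 - exp (- w)) * / eps).
      apply Rmult_le_reg_r with eps; [lra|].
      rewrite Rmult_assoc, Rinv_l, Rmult_1_r by lra.
      apply Rle_trans with (a * e1); [apply Rmult_le_compat_l; lra|].
      unfold e1; replace (a * (b * (1 - exp (- w0)) / a)) with (b * (1 - exp (- w0)))
        by (field; lra).
      apply Rmult_le_compat_l; lra.
    assert (h4 : (c - 3 / 2) * eps <= (c - 3 / 2) * r w) by nra.
    nra.
  exists eps, (fun w => exp (w / 2) * r w); split; [exact he|]; split; [|split].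
  + rewrite hrw; unfold r0.
    replace (exp (w0 / 2) * (p0 * exp (- (w0 / 2))))
      with (p0 * (exp (w0 / 2) * exp (- (w0 / 2)))) by ring.
    rewrite <- exp_plus, Rplus_opp_r, exp_0; ring.
  + intros w h; rewrite Rmult_comm.
    apply Rmult_le_compat_l; [apply Rlt_le, exp_pos | now apply hbar].
  + intros w h.
    assert (hb1 := hbar w h).
    eapply is_derive_eq.
    * apply (is_derive_mult (fun w => exp (w / 2)) r w (exp (w / 2) / 2)
               (phase_field a b c eps w0 w (r w))).
      -- auto_derive; [trivial | unfold Rdiv; field].
      -- now apply hrd'.
      -- intros; apply Rmult_comm.
    * unfold phase_field; rewrite (Rmax_right w0 w h), (Rmax_right eps (r w) hb1).
      unfold plus, mult; simpl.
      set (e := exp (w / 2)).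
      assert (hepos : 0 < e) by apply exp_pos.
      replace (exp (- w / 2)) with (/ e) by
        (unfold e; rewrite <- exp_Ropp; f_equal; field).
      replace (exp w) with (e * e) by
        (unfold e; rewrite <- exp_plus; f_equal; field).
      replace (exp (- w)) with (/ (e * e)) by
        (unfold e; rewrite <- exp_plus, <- exp_Ropp; f_equal; field).
      field; lra.
Qed.

(** * Hitting times and their inverse *)

(** [J] is a mere left inverse, arbitrary off the range of [tau]; the intermediate value theorem
    puts every point near [tau w] in that range. *)
Lemma inverse_continuous (tau J : R -> R) (w : R) :
  (forall x y, x < y -> tau x < tau y) -> (forall x, continuous tau x) ->
  (forall x, J (tau x) = x) -> continuous J (tau w).
Proof.
intros hmon hc hJ; apply continuous_eps; intros e he.
exists (Rmin (tau (w + e / 2) - tau w) (tau w - tau (w - e / 2))); split.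
- apply Rmin_glb_lt; apply Rlt_0_minus, hmon; lra.
- intros t ht.
  assert (h1 := Rlt_le_trans _ _ _ ht (Rmin_l _ _)).
  assert (h2 := Rlt_le_trans _ _ _ ht (Rmin_r _ _)).
  apply Rabs_def2 in h1; apply Rabs_def2 in h2.
  destruct (IVT_gen_consistent tau (w - e / 2) (w + e / 2) t hc) as [x [hx ex]].
  + rewrite Rmin_left, Rmax_right by (apply Rlt_le, hmon; lra); lra.
  + rewrite Rmin_left, Rmax_right in hx by lra.
    rewrite <- ex, !hJ; apply Rabs_def1; lra.
Qed.

(** Differentiability in Caratheodory's form: the slope of [tau] at [w], completed by [l], is a
    continuous function [sl], and the difference quotient of [J] at [tau w] is [/ sl] at the
    preimage. *)
Lemma inverse_derive (tau J : R -> R) (w l : R) :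
  (forall x y, x < y -> tau x < tau y) -> (forall x, continuous tau x) ->
  (forall x, J (tau x) = x) -> is_derive tau w l -> 0 < l ->
  is_derive J (tau w) (/ l).
Proof.
intros hmon hc hJ hd hl.
pose (sl := fun x => if Req_dec_T x w then l else (tau x - tau w) / (x - w)).
assert (slw : sl w = l) by (unfold sl; destruct (Req_dec_T w w); [trivial | lra]).
assert (hsl : continuous sl w).
  apply continuous_eps; intros e he.
  apply is_derive_Reals in hd; destruct (hd e he) as [d hd'].
  exists d; split; [apply cond_pos|]; intros y hy; rewrite slw; unfold sl.
  destruct (Req_dec_T y w) as [_|hne].
  - rewrite Rminus_diag, Rabs_R0; lra.
  - specialize (hd' (y - w) ltac:(lra) hy).
    now replace (w + (y - w)) with y in hd' by ring.
assert (hcomp : continuous (fun t => / sl (J t)) (tau w)).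
  apply continuous_Rinv_comp; [|rewrite hJ, slw; lra].
  apply continuous_comp; [now apply inverse_continuous | now rewrite hJ].
apply is_derive_Reals; intros e he.
destruct (proj1 (continuous_eps _ _) hcomp e he) as [d [hd0 hd']].
rewrite hJ, slw in hd'.
pose (d2 := Rmin d (Rmin (tau (w + 1) - tau w) (tau w - tau (w - 1)))).
assert (hd2 : 0 < d2).
  repeat apply Rmin_glb_lt; trivial; apply Rlt_0_minus, hmon; lra.
exists (mkposreal d2 hd2); simpl; intros k hk0 hk.
assert (h0 : Rabs k < d) by (eapply Rlt_le_trans; [apply hk | apply Rmin_l]).
assert (h1 : Rabs k < tau (w + 1) - tau w)
  by (eapply Rlt_le_trans; [apply hk | eapply Rle_trans; [apply Rmin_r | apply Rmin_l]]).
assert (h2 : Rabs k < tau w - tau (w - 1))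
  by (eapply Rlt_le_trans; [apply hk | eapply Rle_trans; [apply Rmin_r | apply Rmin_r]]).
apply Rabs_def2 in h1; apply Rabs_def2 in h2.
destruct (IVT_gen_consistent tau (w - 1) (w + 1) (tau w + k) hc) as [x [hx ex]].
  rewrite Rmin_left, Rmax_right by (apply Rlt_le, hmon; lra); lra.
specialize (hd' (tau w + k)); rewrite Rplus_minus_l in hd'; specialize (hd' h0).
rewrite <- ex, !hJ in *.
assert (hxw : x <> w) by (intros ->; lra).
unfold sl in hd'; destruct (Req_dec_T x w) as [|_]; [contradiction|].
replace k with (tau x - tau w) by lra.
replace ((x - w) / (tau x - tau w)) with (/ ((tau x - tau w) / (x - w))); [trivial|].
field; split; lra.
Qed.

Lemma monotone_inverse (tau : R -> R) :
  (forall x y, x < y -> tau x < tau y) -> exists J : R -> R, forall x, J (tau x) = x.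
Proof.
intros hmon.
exists (fun t => real (Lub_Rbar (fun x => tau x <= t))); intros x.
rewrite (is_lub_Rbar_unique _ (Finite x)); [trivial|split].
- intros y hy; simpl; apply Rnot_lt_le; intros h; specialize (hmon _ _ h); lra.
- intros m hm; apply (hm x); lra.
Qed.

(* Along a solution with [w_s = q w], [s = ln t], the value [w] is reached at
   time [t0 exp (int_w0^w 1/q)]; the growth of [q] bounds these times. *)
Lemma hitting_time (q : R -> R) (eps w0 t0 : R) :
  0 < eps -> 0 < t0 ->
  (forall w, w0 <= w -> eps * exp (w / 2) <= q w) ->
  (forall w, w0 <= w -> continuous q w) ->
  exists (tau : R -> R) (tm : R), tau w0 = t0 /\
    (forall w, 0 < tau w < tm) /\
    (forall w, is_derive tau w (tau w / q (Rmax w0 w))) /\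
    (forall x y, x < y -> tau x < tau y) /\
    (forall t, t < tm -> exists w, t < tau w).
Proof.
intros he ht0 hq hqc.
(* Freezing [q] to the left of [w0] keeps [tau] strictly increasing on the whole line, so its
   inverse is differentiable from both sides at [t0]. *)
pose (k := fun w => / q (Rmax w0 w)).
assert (hqpos : forall w, w0 <= w -> 0 < q w).
  intros w hw; eapply Rlt_le_trans; [|now apply hq].
  apply Rmult_lt_0_compat; [trivial | apply exp_pos].
assert (hkpos : forall w, 0 < k w) by (intros w; apply Rinv_0_lt_compat, hqpos, Rmax_l).
assert (hkc : forall w, continuous k w).
  intros w; apply continuous_Rinv_comp.
  - apply continuous_comp; [apply continuous_Rmax_l | apply hqc, Rmax_l].
  - apply Rgt_not_eq, hqpos, Rmax_l.
pose (th := fun w => 0 + RInt k w0 w).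
assert (thd : forall w, is_derive th w (k w)) by (intros w; now apply is_derive_RInt_const).
assert (thc : forall w, continuous th w) by (intros w; now apply is_derive_continuous with (k w)).
assert (thmon : forall x y, x < y -> th x < th y).
  intros x y h; apply increasing_of_derive with k; trivial; intros; trivial.
assert (th0 : th w0 = 0) by (unfold th; rewrite RInt_point; unfold zero; simpl; ring).
(* The constant is the integral of [exp (- w / 2) / eps] over [[w0, +oo)]. *)
assert (thb : forall w, th w <= 2 / eps * exp (- w0 / 2)).
  intros w; destruct (Rle_lt_dec w0 w) as [h|h].
  - pose (u := fun w => - (2 / eps * exp (- w / 2)) - th w).
    assert (hu : u w0 <= u w).
      apply nondecreasing_of_derive with (fun w => / (eps * exp (w / 2)) - k w); trivial.
      + intros t _; apply (continuous_minus (V := R_NormedModule)); [|trivial].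
        apply (ex_derive_continuous (V := R_NormedModule)); auto_derive; lra.
      + intros t _; apply (is_derive_minus (V := R_NormedModule)); [|trivial].
        auto_derive; [lra|].
        replace (- t * / 2) with (- (t / 2)) by field.
        rewrite exp_Ropp; field; split; [apply Rgt_not_eq, exp_pos | lra].
      + intros t ht; unfold k; rewrite Rmax_right by lra.
        cut (/ q t <= / (eps * exp (t / 2))); [lra|]; apply Rinv_le_contravar; [|apply hq; lra].
        apply Rmult_lt_0_compat; [trivial | apply exp_pos].
    unfold u in hu; rewrite th0 in hu.
    assert (0 < 2 / eps * exp (- w / 2)); [|lra].
    apply Rmult_lt_0_compat; [apply Rdiv_lt_0_compat; lra | apply exp_pos].
  - specialize (thmon _ _ h); rewrite th0 in thmon.
    assert (0 < 2 / eps * exp (- w0 / 2)); [|lra].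
    apply Rmult_lt_0_compat; [apply Rdiv_lt_0_compat; lra | apply exp_pos].
pose (tau := fun w => t0 * exp (th w)).
assert (taumon : forall x y, x < y -> tau x < tau y).
  intros x y h; apply Rmult_lt_compat_l; [trivial | now apply exp_increasing, thmon].
(* The end time is the supremum of the hitting times; strict monotonicity keeps it from being
   attained. *)
destruct (completeness (fun t => exists w, t = tau w)) as [tm [hub hlub]].
- exists (t0 * exp (2 / eps * exp (- w0 / 2))); intros t [w ->].
  apply Rmult_le_compat_l; [lra | apply exp_monotone, thb].
- now exists (tau w0), w0.
- exists tau, tm; split; [unfold tau; rewrite th0, exp_0; ring|].
  split; [|split; [|split; [trivial|]]].
  + intros w; split; [apply Rmult_lt_0_compat; [trivial | apply exp_pos]|].
    apply Rlt_le_trans with (tau (w + 1)); [apply taumon; lra|].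
    apply hub; now exists (w + 1).
  + intros w; eapply is_derive_eq.
    * apply (is_derive_scal (fun w => exp (th w)) w t0).
      apply (is_derive_comp exp th w); [apply is_derive_exp | apply thd].
    * unfold tau, k, scal; simpl; unfold mult; simpl; unfold Rdiv; ring.
  + intros t ht.
    destruct (Classical_Prop.classic (exists w, t < tau w)) as [h|h]; [trivial|exfalso].
    apply (Rlt_irrefl t); eapply Rlt_le_trans; [apply ht|].
    apply hlub; intros s [w ->]; apply Rnot_lt_le; intros hlt.
    apply h; now exists w.
Qed.

(** Gronwall in squared form: with [M] the maximum of [k], the nonnegative function
    [r ^ 2 * exp (- 2 * M * t)] is nonincreasing and starts at [0]. *)
Lemma linear_ode_zero (r k : R -> R) (x y : R) :
  x <= y ->
  (forall t, x <= t <= y -> continuous r t) ->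
  (forall t, x <= t <= y -> continuous k t) ->
  (forall t, x < t < y -> is_derive r t (k t * r t)) ->
  r x = 0 -> r y = 0.
Proof.
intros hxy hr hk hd h0.
destruct (continuity_ab_maj k x y hxy) as [m [hm _]].
  intros t ht; apply continuity_pt_filterlim, (hk t ht).
set (M := k m) in *.
pose (u := fun t => - ((r t) ^ 2 * exp (- 2 * M * t))).
assert (hu : u x <= u y).
  apply nondecreasing_of_derive
    with (fun t => 2 * (M - k t) * ((r t) ^ 2 * exp (- 2 * M * t))); trivial.
  - intros t ht; apply (continuous_opp (V := R_NormedModule)).
    apply (continuous_mult (K := R_AbsRing)).
    + apply (continuous_comp r (fun x => x ^ 2)); [now apply hr|].
      apply (ex_derive_continuous (V := R_NormedModule)); auto_derive; trivial.
    + apply (ex_derive_continuous (V := R_NormedModule)); auto_derive; trivial.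
  - intros t ht; specialize (hd t ht); unfold u.
    auto_derive; [now exists (k t * r t)|].
    replace (Derive (fun x0 => r x0) t) with (k t * r t)
      by (symmetry; apply is_derive_unique, hd).
    simpl; ring.
  - intros t ht; specialize (hm t ltac:(lra)).
    apply Rmult_le_pos; [lra|].
    apply Rmult_le_pos; [apply pow2_ge_0 | apply Rlt_le, exp_pos].
unfold u in hu; rewrite h0 in hu.
assert (h1 := exp_pos (- 2 * M * y)).
assert (h2 : (r y) ^ 2 <= 0).
  apply Rnot_lt_le; intros h.
  assert (0 < (r y) ^ 2 * exp (- 2 * M * y)) by (apply Rmult_lt_0_compat; trivial).
  simpl in *; lra.
apply Rsqr_0_uniq; unfold Rsqr; generalize (pow2_ge_0 (r y)); simpl in *; lra.
Qed.

(** * Solutions in logarithmic variables *)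

(* In the variables [w = ln (1 + f)], [p = t f' / (1 + f)] the equation becomes
   [t w' = p], [t p' = log_accel w p], autonomous in [ln t]. *)
Definition log_accel (a b c w p : R) : R :=
  (1 - a) * p + b * (exp w - 1) + (c - 1) * p ^ 2.

(** Derivatives are asked only beyond [t0]: a rival solution enters through its constant extension
    to the left, which is continuous at [t0] but may have a corner there. *)
Definition log_curve (a b c t0 T : R) (y z : R -> R) : Prop :=
  forall t, t0 <= t < T -> continuous y t /\ continuous z t /\
    (t0 < t -> is_derive y t (z t / t) /\
               is_derive z t (log_accel a b c (y t) (z t) / t)).

(** The sign of [z] after [t0] is unknown. If [y] fell below its initial value, a maximum point [m]
    on [[t0, t1]] would precede [t1]; but [z] is positive just after [m], so [y] still grows
    there. *)
Lemma log_curve_stays_above (a b c t0 T : R) (y z : R -> R) :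
  0 < b -> 0 < t0 -> 0 < y t0 -> 0 < z t0 -> log_curve a b c t0 T y z ->
  forall t, t0 <= t < T -> y t0 <= y t.
Proof.
intros hb ht0 hy0 hz0 hcurve t1 ht1.
apply Rnot_lt_le; intros hlt.
destruct (continuity_ab_maj y t0 t1 (proj1 ht1)) as [m [hmax hm]].
  intros s hs; apply continuity_pt_filterlim.
  destruct (hcurve s ltac:(lra)) as [h _]; exact h.
assert (hm0 := hmax t0 ltac:(lra)).
assert (hmt : m <> t1) by (intros ->; lra).
destruct (hcurve m ltac:(lra)) as [_ [hzc hd]].
assert (hright : exists d, 0 < d /\ forall h, 0 < h < d -> 0 < z (m + h)).
  (* If [z m < 0], then [y] is larger just before [m], a contradiction; if [z m = 0], the source
     [b * (exp y - 1)] pushes [z] up; if [z m > 0], continuity suffices. *)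
  destruct (Rtotal_order (z m) 0) as [h|[h|h]].
  - assert (hne : m <> t0) by (intros ->; lra).
    destruct (hd ltac:(lra)) as [hdy _].
    destruct (is_derive_pos_near (fun s => - y s) m (- (z m / m))) as [d [hd0 hdm]].
    + apply (is_derive_opp (V := R_NormedModule)), hdy.
    + replace (- (z m / m)) with (- z m / m) by (field; lra).
      apply Rdiv_lt_0_compat; lra.
    + exfalso; pose (k := Rmin (d / 2) (m - t0)).
      assert (0 < k) by (apply Rmin_glb_lt; lra).
      assert (k <= d / 2) by apply Rmin_l; assert (k <= m - t0) by apply Rmin_r.
      specialize (hdm k ltac:(lra)); specialize (hmax (m - k) ltac:(lra)); lra.
  - assert (hne : m <> t0) by (intros ->; lra).
    destruct (hd ltac:(lra)) as [_ hdz].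
    destruct (is_derive_pos_near z m _ hdz) as [d [hd0 hdm]].
    + unfold log_accel; rewrite h; apply Rdiv_lt_0_compat; [|lra].
      assert (1 < exp (y m)) by (rewrite <- exp_0; apply exp_increasing; lra).
      assert (0 < b * (exp (y m) - 1)) by (apply Rmult_lt_0_compat; lra); lra.
    + exists d; split; [trivial | intros k hk; specialize (hdm k hk); lra].
  - destruct (continuous_pos_near z m hzc h) as [d [hd0 hdz]].
    exists d; split; [trivial | intros k hk; apply hdz].
    rewrite Rplus_minus_l, Rabs_pos_eq; lra.
destruct hright as [d [hd0 hpos]].
pose (k := Rmin (d / 2) (t1 - m)).
assert (0 < k) by (apply Rmin_glb_lt; lra).
assert (k <= d / 2) by apply Rmin_l; assert (k <= t1 - m) by apply Rmin_r.
assert (hinc : y m < y (m + k)).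
  apply increasing_of_derive with (fun s => z s / s); [lra | | |].
  - intros s hs; apply hcurve; lra.
  - intros s hs; apply hcurve; lra.
  - intros s hs; apply Rdiv_lt_0_compat; [|lra].
    replace s with (m + (s - m)) by ring; apply hpos; lra.
specialize (hmax (m + k) ltac:(lra)); lra.
Qed.

(** Let [F] be [log_accel] at fixed [w]. Since [q q' = F(q)], one has
    [F(z) - z q' = (F(z) - F(q)) - (z - q) q'], and [F(z) - F(q)] is [(z - q)] times
    [(1 - a) + (c - 1) (z + q)]: hence the coefficient of the linear equation for [z - q(y)]. *)
Lemma log_curve_hitting_time (a b c t0 T : R) (q tau y z : R -> R) :
  0 < b -> 0 < t0 -> 0 < y t0 -> 0 < z t0 -> log_curve a b c t0 T y z ->
  (forall w, y t0 <= w -> 0 < q w) ->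
  (forall w, y t0 <= w ->
     is_derive q w ((1 - a) + (c - 1) * q w + b * (exp w - 1) * / q w)) ->
  q (y t0) = z t0 ->
  (forall w, is_derive tau w (tau w / q (Rmax (y t0) w))) -> tau (y t0) = t0 ->
  forall t, t0 <= t < T -> tau (y t) = t.
Proof.
intros hb ht0 hy0 hz0 hcurve hqpos hq hqz htau htau0.
assert (hab := log_curve_stays_above a b c t0 T y z hb ht0 hy0 hz0 hcurve).
assert (hqc : forall t, t0 <= t < T -> continuous (fun s => q (y s)) t).
  intros t ht; apply continuous_comp; [apply (hcurve t ht)|].
  eapply is_derive_continuous, hq, hab, ht.
assert (hr : forall t, t0 <= t < T -> z t - q (y t) = 0).
  intros t1 ht1.
  apply (linear_ode_zero (fun t => z t - q (y t))
    (fun t => ((1 - a) + (c - 1) * (z t + q (y t))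
       - (((1 - a) + (c - 1) * q (y t) + b * (exp (y t) - 1) * / q (y t)))) * / t) t0 t1).
  - lra.
  - intros t ht; apply (continuous_minus (V := R_NormedModule));
      [apply hcurve; lra | apply hqc; lra].
  - intros t ht.
    destruct (hcurve t ltac:(lra)) as [hyc [hzc _]].
    assert (hqt := hqc t ltac:(lra)).
    assert (hqp := hqpos (y t) (hab t ltac:(lra))).
    apply (continuous_mult (K := R_AbsRing));
      [|apply continuous_Rinv_comp; [apply continuous_id | lra]].
    apply (continuous_minus (V := R_NormedModule)).
    + apply (continuous_plus (V := R_NormedModule)); [apply continuous_const|].
      apply (continuous_mult (K := R_AbsRing)); [apply continuous_const|].
      apply (continuous_plus (V := R_NormedModule)); trivial.
    + apply (continuous_plus (V := R_NormedModule)).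
      * apply (continuous_plus (V := R_NormedModule)); [apply continuous_const|].
        apply (continuous_mult (K := R_AbsRing)); [apply continuous_const | trivial].
      * apply (continuous_mult (K := R_AbsRing)).
        -- apply (continuous_mult (K := R_AbsRing)); [apply continuous_const|].
           apply (continuous_minus (V := R_NormedModule)); [|apply continuous_const].
           now apply continuous_exp_comp.
        -- apply continuous_Rinv_comp; [trivial | lra].
  - intros t ht.
    destruct (hcurve t ltac:(lra)) as [_ [_ hd]].
    destruct (hd ltac:(lra)) as [hdy hdz].
    assert (hqp := hqpos (y t) (hab t ltac:(lra))).
    eapply is_derive_eq.
    + apply (is_derive_minus (V := R_NormedModule)); [apply hdz|].
      apply (is_derive_comp (V := R_NormedModule) q y); [apply hq, hab; lra | apply hdy].
    + unfold log_accel, minus, plus, opp, scal; simpl; unfold mult; simpl.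
      field; lra.
  - rewrite hqz; lra.
intros t ht.
destruct (proj1 ht) as [hlt|<-]; [|trivial].
(* Once [z = q(y)], both [tau (y s)] and [s] have logarithmic derivative [1 / s]. *)
assert (hdt : forall s, t0 < s < t -> is_derive (fun s => tau (y s) / s) s 0).
  intros s hs.
  destruct (hcurve s ltac:(lra)) as [_ [_ hd]].
  destruct (hd ltac:(lra)) as [hdy _].
  assert (hys := hab s ltac:(lra)).
  assert (hqp := hqpos (y s) hys).
  assert (hts := htau (y s)); rewrite (Rmax_right _ _ hys) in hts.
  assert (hrs := hr s ltac:(lra)).
  eapply is_derive_eq.
  - apply (is_derive_div (fun s => tau (y s)) id s); [|apply is_derive_id|unfold id; lra].
    apply (is_derive_comp (V := R_NormedModule) tau y); eassumption.
  - unfold id, one, minus, plus, opp, scal; simpl; unfold mult; simpl.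
    replace (z s) with (q (y s)) by lra; field; lra.
destruct (mean_value (fun s => tau (y s) / s) (fun _ => 0) t0 t hlt) as [s [hs e]];
  [|exact hdt|].
- intros s hs; apply (continuous_mult (K := R_AbsRing)).
  + apply continuous_comp; [apply hcurve; lra | eapply is_derive_continuous, htau].
  + apply continuous_Rinv_comp; [apply continuous_id | lra].
- rewrite htau0 in e.
  replace (tau (y t)) with (tau (y t) / t * t) by (field; lra).
  replace (tau (y t) / t) with 1; [ring|].
  replace (t0 / t0) with 1 in e by (field; lra); lra.
Qed.

(** The floor [eps <= p] is what makes [f'] diverge together with [f]. Uniqueness is stated against
    [log_curve], so that rivals with a corner at [t0] are covered. *)
Theorem log_solution (a b c t0 w0 p0 : R) :
  1 < a -> 0 < b -> 1 < c < 3 / 2 -> 0 < t0 -> 0 < w0 -> 0 < p0 ->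
  exists (tm eps : R) (w p : R -> R),
    t0 < tm /\ 0 < eps /\ w t0 = w0 /\ p t0 = p0 /\
    (forall t, t0 <= t < tm -> w0 <= w t /\ eps <= p t /\
       is_derive w t (p t / t) /\ is_derive p t (log_accel a b c (w t) (p t) / t)) /\
    (forall M, exists t1, t1 < tm /\ forall t, t1 < t < tm -> M < w t) /\
    (forall y z, log_curve a b c t0 tm y z -> y t0 = w0 -> z t0 = p0 ->
       forall t, t0 <= t < tm -> y t = w t).
Proof.
intros ha hb hc ht0 hw0 hp0.
destruct (phase_curve a b c w0 p0 ha hb hc hw0 hp0) as [eps [q [he [hq0 [hqle hqd]]]]].
destruct (hitting_time q eps w0 t0 he ht0 hqle) as [tau [tm [htau0 [hb1 [htd [hmon hsup]]]]]].
  intros w hw; eapply is_derive_continuous; now apply hqd.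
destruct (monotone_inverse tau hmon) as [J hJ].
assert (hqe : forall w, w0 <= w -> eps <= q w).
  intros w hw; eapply Rle_trans; [|now apply hqle].
  assert (1 <= exp (w / 2)) by (rewrite <- exp_0; apply exp_monotone; lra); nra.
assert (htc : forall w, continuous tau w).
  intros w; eapply is_derive_continuous, htd.
assert (hreach : forall t, t0 <= t < tm -> exists w, w0 <= w /\ tau w = t).
  intros t ht; destruct (hsup t (proj2 ht)) as [w1 hw1].
  assert (h01 : w0 < w1).
    apply Rnot_le_lt; intros [h|h]; [specialize (hmon _ _ h); lra | subst; lra].
  destruct (IVT_gen_consistent tau w0 w1 t htc) as [w [hw e]].
  - rewrite Rmin_left, Rmax_right by (apply Rlt_le, hmon; lra); lra.
  - rewrite Rmin_left in hw by lra; now exists w.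
exists tm, eps, J, (fun t => q (J t)).
split; [rewrite <- htau0; apply hb1|].
split; [trivial|].
split; [rewrite <- htau0; apply hJ|].
split; [rewrite <- htau0, hJ; trivial|].
split; [|split].
- intros t ht; destruct (hreach t ht) as [w [hw <-]]; rewrite hJ.
  split; [trivial|]; split; [now apply hqe|].
  assert (hqp := hqe w hw).
  assert (htp := proj1 (hb1 w)).
  assert (hJd : is_derive J (tau w) (q w / tau w)).
    assert (hd := htd w); rewrite (Rmax_right _ _ hw) in hd.
    eapply is_derive_eq; [apply (inverse_derive tau J w _ hmon htc hJ hd)|].
    + apply Rdiv_lt_0_compat; lra.
    + field; lra.
  split; [trivial|].
  eapply is_derive_eq.
  + apply (is_derive_comp (V := R_NormedModule) q J); [rewrite hJ; now apply hqd | apply hJd].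
  + unfold log_accel, scal; simpl; unfold mult; simpl; field; lra.
- intros M; pose (M' := Rmax w0 M).
  assert (h1 : w0 <= M') by apply Rmax_l; assert (h2 : M <= M') by apply Rmax_r.
  exists (tau M'); split; [apply hb1|]; intros t ht.
  destruct (hreach t) as [w [hw <-]].
  + split; [|lra]; rewrite <- htau0; destruct h1 as [h1|h1]; [|rewrite h1; lra].
    specialize (hmon _ _ h1); lra.
  + rewrite hJ; apply Rnot_le_lt; intros h.
    destruct (Rle_lt_or_eq_dec w M' ltac:(lra)) as [h3|h3];
      [specialize (hmon _ _ h3); lra | subst; lra].
- intros y z hcurve hy0 hz0 t ht.
  rewrite <- (hJ (y t)); f_equal; subst w0 p0.
  apply (log_curve_hitting_time a b c t0 tm q tau y z); trivial.
  + now rewrite hz0.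
  + intros w hw; specialize (hqe w hw); lra.
  + now symmetry.
Qed.

(** * Back to the original equation *)

Lemma is_derive_within_of_is_derive (S : R -> Prop) (f : R -> R) (x l : R) :
  S x -> is_derive f x l -> is_derive_within S f x l.
Proof.
intros hx hd.
assert (hF : ProperFilter (within S (locally x))).
  split; [|apply within_filter, locally_filter].
  intros P hP; exists x; now apply (locally_singleton x _ hP).
apply (filterdiff_locally f x); [|exact hd].
apply filter_le_within.
Qed.

Lemma is_derive_of_within (S : R -> Prop) (f : R -> R) (x l : R) :
  locally x S -> is_derive_within S f x l -> is_derive f x l.
Proof.
intros hS [hl hd]; split; [exact hl | intros y hy].
apply (is_domin_le (F := within S (locally x)) (G := locally x)).
- apply hd; intros P hP; apply filter_le_within; now apply hy.
- intros P hP; generalize (filter_and _ _ hS hP); apply filter_imp.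
  intros z [h1 h2]; now apply h2.
Qed.

Lemma Ico_locally (t0 T t : R) : t0 < t < T -> locally t (Ico t0 T).
Proof.
intros ht; assert (h : locally t (fun s => t0 < s /\ s < T)).
  apply filter_and; [apply (open_gt t0 t) | apply (open_lt T t)]; lra.
revert h; apply filter_imp; intros s hs; split; simpl; lra.
Qed.

Lemma continuous_Rmax_of_within (t0 T : R) (f : R -> R) (t l : R) :
  t0 <= t < T -> is_derive_within (Ico t0 T) f t l ->
  continuous (fun s => f (Rmax t0 s)) t.
Proof.
intros ht hd; unfold continuous; rewrite Rmax_right by lra.
apply (filterlim_comp _ _ _ (Rmax t0) f _ (within (Ico t0 T) (locally t))).
- intros P hP.
  assert (hc := continuous_Rmax_l t0 t); unfold continuous in hc.
  rewrite Rmax_right in hc by lra; specialize (hc _ hP).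
  assert (hT : locally t (fun s => s < T)) by (apply (open_lt T t); lra).
  unfold filtermap in *; generalize (filter_and _ _ hc hT).
  apply filter_imp; intros s [h1 h2]; apply h1; split; simpl.
  + apply Rmax_l.
  + apply Rmax_lub_lt; lra.
- apply (filterdiff_continuous_aux (U := AbsRing_NormedModule R_AbsRing)
    (V := R_NormedModule) f); [eexists; apply hd | apply filter_le_within].
Qed.

Lemma is_derive_Rmax_of_within (t0 T : R) (f : R -> R) (t l : R) :
  t0 < t < T -> is_derive_within (Ico t0 T) f t l ->
  is_derive (fun s => f (Rmax t0 s)) t l.
Proof.
intros ht hd.
apply (is_derive_ext_loc f).
- assert (h : locally t (fun s => t0 < s)) by (apply (open_gt t0 t); lra).
  revert h; apply filter_imp; intros s hs; now rewrite Rmax_right by lra.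
- now apply (is_derive_of_within (Ico t0 T)); [apply Ico_locally|].
Qed.

Lemma nonvanishing_pos (h : R -> R) (x y : R) :
  x <= y -> (forall t, x <= t <= y -> continuous h t) ->
  (forall t, x <= t <= y -> h t <> 0) -> 0 < h x -> 0 < h y.
Proof.
intros hxy hc hn hx.
destruct (Rtotal_order (h y) 0) as [hy|[hy|hy]]; [|now destruct (hn y ltac:(lra))|trivial].
assert (hlt : x < y) by (destruct hxy as [|e]; [trivial | subst; lra]).
destruct (IVT_interv (fun t => - h t) x y) as [t [ht e]]; try lra.
- intros t ht; apply continuity_pt_opp, continuity_pt_filterlim, hc, ht.
- destruct (hn t ht); lra.
Qed.

(** A rival solution is only known to keep [1 + g] nonzero; as [1 + u > 0], the intermediate value
    theorem excludes a change of sign, so its logarithm is legitimate. *)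
Lemma log_curve_of_solution (a b c t0 u v T : R) (g g0 : R -> R) :
  0 < t0 -> 0 < u -> is_solution a b c t0 u v T g g0 ->
  (forall t, t0 <= t < T -> 0 < 1 + g t) /\
  log_curve a b c t0 T (fun t => ln (1 + g (Rmax t0 t)))
    (fun t => Rmax t0 t * g0 (Rmax t0 t) / (1 + g (Rmax t0 t))).
Proof.
intros ht0 hu [g00 [[hd1 [hd2 _]] [heq [hgu hgv]]]].
assert (hI : forall t, t0 <= t < T -> Ico t0 T t) by (intros t ht; split; simpl; lra).
assert (hgc : forall t, t0 <= t < T -> continuous (fun s => g (Rmax t0 s)) t).
  intros t ht; apply (continuous_Rmax_of_within t0 T g t (g0 t) ht), hd1, hI, ht.
assert (hg0c : forall t, t0 <= t < T -> continuous (fun s => g0 (Rmax t0 s)) t).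
  intros t ht; apply (continuous_Rmax_of_within t0 T g0 t (g00 t) ht), hd2, hI, ht.
assert (h1gc : forall t, t0 <= t < T -> continuous (fun s => 1 + g (Rmax t0 s)) t).
  intros t ht; apply (continuous_plus (V := R_NormedModule));
    [apply continuous_const | now apply hgc].
assert (hpos : forall t, t0 <= t < T -> 0 < 1 + g t).
  intros t ht.
  assert (h := nonvanishing_pos (fun s => 1 + g (Rmax t0 s)) t0 t (proj1 ht)).
  simpl in h; rewrite !Rmax_right in h by lra; apply h.
  - intros s hs; apply h1gc; lra.
  - intros s hs; rewrite Rmax_right by lra; apply heq, hI; lra.
  - rewrite hgu; lra.
split; [exact hpos|]; intros t ht.
assert (hp := hpos t ht).
assert (hmt : Rmax t0 t = t) by (apply Rmax_right; lra).
split; [|split].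
- apply continuous_comp; [now apply h1gc|].
  rewrite hmt; apply (is_derive_continuous ln _ (/ (1 + g t))), is_derive_ln, hp.
- apply (continuous_mult (K := R_AbsRing)).
  + apply (continuous_mult (K := R_AbsRing)); [apply continuous_Rmax_l | now apply hg0c].
  + apply continuous_Rinv_comp; [now apply h1gc | rewrite hmt; lra].
- intros hlt.
  assert (hid : is_derive (fun s => Rmax t0 s) t 1).
    apply (is_derive_ext_loc id); [|apply (is_derive_id (K := R_AbsRing))].
    assert (h : locally t (fun s => t0 < s)) by (apply (open_gt t0 t); lra).
    revert h; apply filter_imp; intros s hs; now rewrite Rmax_right by lra.
  assert (hgd := is_derive_Rmax_of_within t0 T g t (g0 t) ltac:(lra) (hd1 t (hI t ht))).
  assert (hg0d := is_derive_Rmax_of_within t0 T g0 t (g00 t) ltac:(lra) (hd2 t (hI t ht))).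
  destruct (heq t (hI t ht)) as [_ e].
  assert (h1gd : is_derive (fun s => 1 + g (Rmax t0 s)) t (g0 t)).
    eapply is_derive_eq; [apply (is_derive_plus (V := R_NormedModule));
      [apply (is_derive_const (V := R_NormedModule)) | apply hgd]|].
    apply (plus_zero_l (g0 t)).
  split.
  + eapply is_derive_eq.
    * apply (is_derive_comp (V := R_NormedModule) ln (fun s => 1 + g (Rmax t0 s)));
        [apply is_derive_ln; rewrite hmt; exact hp | apply h1gd].
    * rewrite hmt; unfold scal; simpl; unfold mult; simpl; field; lra.
  + eapply is_derive_eq.
    * apply (is_derive_div (fun s => Rmax t0 s * g0 (Rmax t0 s))
               (fun s => 1 + g (Rmax t0 s))); [|apply h1gd | rewrite hmt; lra].
      apply (is_derive_mult (fun s => Rmax t0 s) (fun s => g0 (Rmax t0 s)) t 1 (g00 t));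
        [exact hid | exact hg0d | intros; apply Rmult_comm].
    * unfold log_accel; rewrite hmt, exp_ln by trivial.
      unfold plus, mult; simpl.
      replace (g00 t) with (- (a / t * g0 t) + b / t ^ 2 * g t * (1 + g t)
         + c / (1 + g t) * (g0 t) ^ 2) by lra.
      field; lra.
Qed.

Lemma solution_of_log_curve (a b c t0 u v T : R) (w p : R -> R) :
  0 < t0 -> 0 < u -> w t0 = ln (1 + u) -> p t0 = t0 * v / (1 + u) ->
  (forall t, t0 <= t < T -> is_derive w t (p t / t) /\
     is_derive p t (log_accel a b c (w t) (p t) / t)) ->
  is_solution a b c t0 u v T (fun t => exp (w t) - 1) (fun t => exp (w t) * p t / t).
Proof.
intros ht0 hu hw0 hp0 hd.
pose (f := fun t => exp (w t) - 1); pose (f0 := fun t => exp (w t) * p t / t).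
(* This is the equation solved for [f'']; the content is then that [f00] is the derivative of
   [f0]. *)
pose (f00 := fun t => - (a / t * f0 t) + b / t ^ 2 * f t * (1 + f t)
                      + c / (1 + f t) * (f0 t) ^ 2).
assert (hI : forall t, Ico t0 T t -> t0 <= t < T) by (intros t []; simpl in *; lra).
assert (hf : forall t, t0 <= t < T -> is_derive f t (f0 t)).
  intros t ht; destruct (hd t ht) as [hw _]; unfold f, f0.
  auto_derive; [now eexists; apply hw|].
  replace (Derive (fun x => w x) t) with (p t / t)
    by (symmetry; apply is_derive_unique, hw).
  field; lra.
assert (hf0 : forall t, t0 <= t < T -> is_derive f0 t (f00 t)).
  intros t ht; destruct (hd t ht) as [hw hp]; unfold f00, f, f0.
  auto_derive.
  - split; [now eexists; apply hw|]; split; [now eexists; apply hp|]; split; [lra | trivial].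
  - replace (Derive (fun x => w x) t) with (p t / t)
      by (symmetry; apply is_derive_unique, hw).
    replace (Derive (fun x => p x) t) with (log_accel a b c (w t) (p t) / t)
      by (symmetry; apply is_derive_unique, hp).
    unfold log_accel; assert (he := exp_pos (w t)).
    field; lra.
exists f00; split; [split; [|split]|split; [|split]].
- intros t ht; apply is_derive_within_of_is_derive; [trivial | apply hf, hI, ht].
- intros t ht; apply is_derive_within_of_is_derive; [trivial | apply hf0, hI, ht].
- intros t ht.
  assert (hc : continuous f00 t).
    apply (ex_derive_continuous (V := R_NormedModule)); unfold f00.
    assert (he : 1 + f t <> 0) by (unfold f; generalize (exp_pos (w t)); lra).
    assert (h1 : ex_derive f t) by (eexists; apply hf, hI, ht).
    assert (h2 : ex_derive f0 t) by (eexists; apply hf0, hI, ht).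
    assert (h3 := hI t ht).
    auto_derive; repeat split; trivial; nra.
  intros P hP; apply filter_le_within, hc, hP.
- intros t ht; split; [unfold f; generalize (exp_pos (w t)); lra|].
  unfold f00, f0, f; lra.
- rewrite hw0, exp_ln by lra; ring.
- rewrite hw0, hp0, exp_ln by lra; field; lra.
Qed.

(** * Comparison with the Euler equation *)

Lemma Rpower_pos (x y : R) : 0 < Rpower x y.
Proof. apply exp_pos. Qed.

Lemma is_derive_Rpower (k t : R) : 0 < t ->
  is_derive (fun t => Rpower t k) t (k * Rpower t k / t).
Proof. intros ht; unfold Rpower; auto_derive; [trivial | field; lra]. Qed.

Lemma Rpower_div (t t0 k : R) : 0 < t -> 0 < t0 ->
  Rpower (t / t0) k = Rpower t0 (- k) * Rpower t k.
Proof.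
intros ht ht0; unfold Rpower; rewrite ln_div, <- exp_plus by trivial.
f_equal; ring.
Qed.

Lemma Rpower_ge1 (x k : R) : 1 <= x -> 0 <= k -> 1 <= Rpower x k.
Proof.
intros hx hk; unfold Rpower; rewrite <- exp_0; apply exp_monotone.
apply Rmult_le_pos; [trivial | rewrite <- ln_1; apply Rcomplements.ln_le; lra].
Qed.

Lemma Rpower_neg_le1 (x k : R) : 1 <= x -> 0 <= k -> Rpower x (- k) <= 1.
Proof.
intros hx hk; rewrite Rpower_Ropp, <- Rinv_1.
apply Rinv_le_contravar; [lra | now apply Rpower_ge1].
Qed.

(** In [s = ln t], [N = D_s] and [Z = N_s], so the hypothesis reads
    [(d/ds - lam) (d/ds + mu) D > 0]. The factors are inverted one at a time: [(N + mu D) t^(-lam)]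
    increases from [0], then so does [D t^mu]. *)
Lemma linear_comparison (lam mu t0 T : R) (D N Z : R -> R) :
  0 < t0 -> D t0 = 0 -> N t0 = 0 ->
  (forall t, t0 <= t < T -> is_derive D t (N t / t) /\ is_derive N t (Z t / t) /\
     (lam - mu) * N t + lam * mu * D t < Z t) ->
  forall t, t0 < t < T -> 0 < D t.
Proof.
intros ht0 hD0 hN0 h.
assert (hc : forall k t, t0 <= t < T -> continuous (fun t => Rpower t k) t).
  intros k t ht; eapply is_derive_continuous, is_derive_Rpower; lra.
assert (hDc : forall t, t0 <= t < T -> continuous D t)
  by (intros t ht; exact (is_derive_continuous D t _ (proj1 (h t ht)))).
assert (hNc : forall t, t0 <= t < T -> continuous N t)
  by (intros t ht; exact (is_derive_continuous N t _ (proj1 (proj2 (h t ht))))).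
assert (hk : forall t, t0 < t < T -> 0 < N t + mu * D t).
  intros t ht.
  assert (hi : (N t0 + mu * D t0) * Rpower t0 (- lam) < (N t + mu * D t) * Rpower t (- lam)).
    apply increasing_of_derive with (f := fun t => (N t + mu * D t) * Rpower t (- lam))
      (df := fun t => Rpower t (- lam) / t
               * (Z t - ((lam - mu) * N t + lam * mu * D t))).
    - lra.
    - intros s hs; apply (continuous_mult (K := R_AbsRing)); [|apply hc; lra].
      apply (continuous_plus (V := R_NormedModule)); [apply hNc; lra|].
      apply (continuous_mult (K := R_AbsRing)); [apply continuous_const | apply hDc; lra].
    - intros s hs; destruct (h s ltac:(lra)) as [hd [hn _]].
      eapply is_derive_eq.
      + apply (is_derive_mult (fun t => N t + mu * D t) (fun t => Rpower t (- lam)) s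
                 (Z s / s + mu * (N s / s))).
        * apply (is_derive_plus (V := R_NormedModule)); [exact hn|].
          apply (is_derive_scal D s mu _ hd).
        * apply is_derive_Rpower; lra.
        * intros; apply Rmult_comm.
      + unfold plus, mult; simpl; field; lra.
    - intros s hs; destruct (h s ltac:(lra)) as [_ [_ hz]].
      apply Rmult_lt_0_compat; [|lra].
      apply Rdiv_lt_0_compat; [apply Rpower_pos | lra].
  rewrite hD0, hN0 in hi.
  assert (hp := Rpower_pos t (- lam)).
  apply Rmult_lt_reg_r with (Rpower t (- lam)); lra.
intros t ht.
assert (hi : D t0 * Rpower t0 mu < D t * Rpower t mu).
  apply increasing_of_derive with (f := fun t => D t * Rpower t mu)
    (df := fun t => Rpower t mu / t * (N t + mu * D t)).
  - lra.
  - intros s hs; apply (continuous_mult (K := R_AbsRing)); [apply hDc; lra | apply hc; lra].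
  - intros s hs; destruct (h s ltac:(lra)) as [hd _].
    eapply is_derive_eq.
    + apply (is_derive_mult D (fun t => Rpower t mu) s (N s / s)); [exact hd | |].
      * apply is_derive_Rpower; lra.
      * intros; apply Rmult_comm.
    + unfold plus, mult; simpl; field; lra.
  - intros s hs; apply Rmult_lt_0_compat; [|apply hk; lra].
    apply Rdiv_lt_0_compat; [apply Rpower_pos | lra].
rewrite hD0 in hi; assert (hp := Rpower_pos t mu).
apply Rmult_lt_reg_r with (Rpower t mu); lra.
Qed.

(* The solution of [y_ss = (lam - mu) y_s + lam mu y], [s = ln t], with
   [y = y0], [y_s = y1] at [t0]; [euler_sol_log] is [y_s]. *)
Definition euler_sol (lam mu t0 y0 y1 t : R) : R :=
  (mu * y0 + y1) / (lam + mu) * Rpower (t / t0) lam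
  + (lam * y0 - y1) / (lam + mu) * Rpower (t / t0) (- mu).

Definition euler_sol_log (lam mu t0 y0 y1 t : R) : R :=
  lam * ((mu * y0 + y1) / (lam + mu)) * Rpower (t / t0) lam
  - mu * ((lam * y0 - y1) / (lam + mu)) * Rpower (t / t0) (- mu).

Lemma is_derive_Rpower_div (k t0 t : R) : 0 < t0 -> 0 < t ->
  is_derive (fun t => Rpower (t / t0) k) t (k * Rpower (t / t0) k / t).
Proof.
intros ht0 ht; unfold Rpower; auto_derive.
- apply Rmult_lt_0_compat; [trivial | now apply Rinv_0_lt_compat].
- unfold Rdiv; field; lra.
Qed.

Lemma euler_sol_derive (lam mu t0 y0 y1 t : R) : 0 < t0 -> 0 < t ->
  is_derive (euler_sol lam mu t0 y0 y1) t (euler_sol_log lam mu t0 y0 y1 t / t).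
Proof.
intros ht0 ht; unfold euler_sol, euler_sol_log; eapply is_derive_eq.
- apply (is_derive_plus (V := R_NormedModule));
    apply is_derive_scal; now apply is_derive_Rpower_div.
- unfold plus; simpl; unfold Rdiv; ring.
Qed.

Lemma euler_sol_log_derive (lam mu t0 y0 y1 t : R) : 0 < t0 -> 0 < t ->
  is_derive (euler_sol_log lam mu t0 y0 y1) t
    (((lam - mu) * euler_sol_log lam mu t0 y0 y1 t
      + lam * mu * euler_sol lam mu t0 y0 y1 t) / t).
Proof.
intros ht0 ht; unfold euler_sol, euler_sol_log; eapply is_derive_eq.
- apply (is_derive_minus (V := R_NormedModule));
    apply is_derive_scal; now apply is_derive_Rpower_div.
- unfold minus, plus, opp; simpl; unfold Rdiv; ring.
Qed.

Lemma Rpower_1_base (k : R) : Rpower 1 k = 1.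
Proof. unfold Rpower; rewrite ln_1, Rmult_0_r; apply exp_0. Qed.

Lemma euler_sol_init (lam mu t0 y0 y1 : R) : 0 < t0 -> 0 < lam + mu ->
  euler_sol lam mu t0 y0 y1 t0 = y0 /\ euler_sol_log lam mu t0 y0 y1 t0 = y1.
Proof.
intros ht0 h; unfold euler_sol, euler_sol_log.
replace (t0 / t0) with 1 by (field; lra); rewrite !Rpower_1_base.
split; field; lra.
Qed.

Lemma ratio_ge1 (t0 t : R) : 0 < t0 -> t0 <= t -> 1 <= t / t0.
Proof.
intros h0 h; apply Rmult_le_reg_r with t0; [trivial|].
unfold Rdiv; rewrite Rmult_assoc, Rinv_l by lra; lra.
Qed.

Lemma euler_sol_increasing (lam mu t0 y0 y1 s t : R) :
  0 < lam -> 0 < mu -> 0 < t0 -> 0 <= y0 -> 0 < y1 -> t0 <= s < t ->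
  euler_sol lam mu t0 y0 y1 s < euler_sol lam mu t0 y0 y1 t.
Proof.
intros hl hm ht0 hy0 hy1 hst.
apply increasing_of_derive with (fun t => euler_sol_log lam mu t0 y0 y1 t / t).
- lra.
- intros r hr; eapply is_derive_continuous, euler_sol_derive; lra.
- intros r hr; apply euler_sol_derive; lra.
- intros r hr; apply Rdiv_lt_0_compat; [|lra]; unfold euler_sol_log.
  assert (h1 := Rpower_ge1 (r / t0) lam (ratio_ge1 t0 r ht0 ltac:(lra)) ltac:(lra)).
  assert (h2 := Rpower_neg_le1 (r / t0) mu (ratio_ge1 t0 r ht0 ltac:(lra)) ltac:(lra)).
  assert (h3 := Rpower_pos (r / t0) (- mu)).
  set (X := Rpower (r / t0) lam) in *; set (Y := Rpower (r / t0) (- mu)) in *.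
  assert (ha : 0 < (mu * y0 + y1) / (lam + mu)) by (apply Rdiv_lt_0_compat; nra).
  (* [lam * y0 - y1] has no definite sign; regrouping around [X - Y >= 0] makes every term
     nonnegative. *)
  replace (lam * ((mu * y0 + y1) / (lam + mu)) * X - mu * ((lam * y0 - y1) / (lam + mu)) * Y)
    with (lam * ((mu * y0 + y1) / (lam + mu)) * (X - Y) + y1 * Y) by (field; lra).
  assert (0 <= lam * ((mu * y0 + y1) / (lam + mu)) * (X - Y)).
    apply Rmult_le_pos; [apply Rmult_le_pos|]; lra.
  assert (0 < y1 * Y) by (apply Rmult_lt_0_compat; lra); lra.
Qed.

Lemma euler_sol_reaches_1 (lam mu t0 y0 y1 : R) :
  0 < lam -> 0 < mu -> 0 < t0 -> 0 < y0 < 1 -> 0 < y1 ->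
  exists t, t0 < t /\ euler_sol lam mu t0 y0 y1 t = 1.
Proof.
intros hl hm ht0 hy0 hy1.
set (al := (mu * y0 + y1) / (lam + mu)).
set (be := (lam * y0 - y1) / (lam + mu)).
assert (hal : 0 < al) by (apply Rdiv_lt_0_compat; nra).
(* Chosen so that [al * (1 + lam * z) = al + 1 + Rabs be]; by [1 + x <= exp x] the growing mode then
   exceeds [1 + Rabs be]. *)
pose (z := (1 + Rabs be) / (al * lam)).
assert (hbe := Rabs_pos be).
assert (hz : 0 < z) by (apply Rdiv_lt_0_compat; nra).
pose (t2 := t0 * exp z).
assert (hez : 1 < exp z) by (rewrite <- exp_0; now apply exp_increasing).
assert (ht2 : t0 < t2) by (unfold t2; nra).
assert (h2 : 1 < euler_sol lam mu t0 y0 y1 t2).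
  unfold euler_sol; fold al be.
  assert (h4 := Rpower_neg_le1 (t2 / t0) mu (ratio_ge1 t0 t2 ht0 ltac:(lra)) ltac:(lra)).
  assert (h3 := Rpower_pos (t2 / t0) (- mu)).
  set (Y := Rpower (t2 / t0) (- mu)) in *.
  replace (t2 / t0) with (exp z) by (unfold t2; field; lra).
  unfold Rpower; rewrite ln_exp.
  assert (h5 := exp_ineq1_le (lam * z)).
  assert (h6 : al * (1 + lam * z) = al + 1 + Rabs be) by (unfold z; field; lra).
  assert (h7 : al * (1 + lam * z) <= al * exp (lam * z)) by (apply Rmult_le_compat_l; lra).
  assert (h8 : - Rabs be <= be * Y).
    apply Rle_trans with (- Rabs (be * Y)).
    - rewrite Rabs_mult, (Rabs_pos_eq Y) by lra; nra.
    - generalize (Rle_abs (- (be * Y))); rewrite Rabs_Ropp; lra.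
  lra.
destruct (euler_sol_init lam mu t0 y0 y1 ht0 ltac:(lra)) as [h0 _].
destruct (IVT_interv (fun t => euler_sol lam mu t0 y0 y1 t - 1) t0 t2) as [t [ht e]]; try lra.
- intros t ht; apply continuity_pt_minus; [|apply continuity_pt_const; now intros ? ?].
  apply continuity_pt_filterlim.
  eapply is_derive_continuous, euler_sol_derive; lra.
- exists t; split; [|lra].
  destruct (proj1 ht) as [|<-]; [trivial | lra].
Qed.

(* [1 - 1 / (1 + f)] is a strict subsolution of the linear Euler equation because [c < 2]. *)
Lemma log_curve_upper (a b c lam mu t0 T : R) (w p : R -> R) :
  c < 2 -> 0 < t0 -> 0 < lam + mu -> lam - mu = 1 - a -> lam * mu = b ->
  (forall t, t0 <= t < T -> 0 < p t /\ is_derive w t (p t / t) /\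
     is_derive p t (log_accel a b c (w t) (p t) / t)) ->
  forall t, t0 < t < T ->
    1 - exp (- w t)
      < euler_sol lam mu t0 (1 - exp (- w t0)) (exp (- w t0) * p t0) t.
Proof.
intros hc ht0 hlm hd hm h t ht.
set (y0 := 1 - exp (- w t0)); set (y1 := exp (- w t0) * p t0).
destruct (euler_sol_init lam mu t0 y0 y1 ht0 hlm) as [e0 e1].
cut (0 < euler_sol lam mu t0 y0 y1 t - (1 - exp (- w t))); [lra|].
apply (linear_comparison lam mu t0 T
  (fun t => euler_sol lam mu t0 y0 y1 t - (1 - exp (- w t)))
  (fun t => euler_sol_log lam mu t0 y0 y1 t - exp (- w t) * p t)
  (fun t => (lam - mu) * euler_sol_log lam mu t0 y0 y1 t
            + lam * mu * euler_sol lam mu t0 y0 y1 t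
            - exp (- w t) * (log_accel a b c (w t) (p t) - (p t) ^ 2)));
  [exact ht0 | rewrite e0; unfold y0; ring | rewrite e1; unfold y1; ring | | exact ht].
intros s hs; destruct (h s hs) as [hp [hw hpd]].
assert (hdw : Derive (fun x => w x) s = p s / s) by apply is_derive_unique, hw.
assert (hdp : Derive (fun x => p x) s = log_accel a b c (w s) (p s) / s)
  by apply is_derive_unique, hpd.
assert (hexw : ex_derive w s) by (eexists; apply hw).
assert (hexp : ex_derive p s) by (eexists; apply hpd).
split; [|split].
- eapply is_derive_eq.
  + eapply (is_derive_minus (V := R_NormedModule)
      (euler_sol lam mu t0 y0 y1) (fun t => 1 - exp (- w t)) s _ (exp (- w s) * p s / s)).
    * apply euler_sol_derive; lra.
    * auto_derive; [trivial | rewrite hdw; field; lra].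
  + unfold minus, plus, opp; simpl; field; lra.
- eapply is_derive_eq.
  + eapply (is_derive_minus (V := R_NormedModule)
      (euler_sol_log lam mu t0 y0 y1) (fun t => exp (- w t) * p t) s _
      (exp (- w s) * (log_accel a b c (w s) (p s) - (p s) ^ 2) / s)).
    * apply euler_sol_log_derive; lra.
    * auto_derive; [repeat split; trivial | rewrite hdw, hdp; field; lra].
  + unfold minus, plus, opp; simpl; field; lra.
- assert (he := exp_pos (- w s)).
  (* For [g = 1 - exp (- w)] the source becomes exactly linear,
     [exp (- w) * b * (exp w - 1) = b * g]; the only remainder is
     [- (2 - c) * exp (- w) * p ^ 2]. *)
  assert (hone : exp (- w s) * exp (w s) = 1)
    by (rewrite <- exp_plus, Rplus_opp_l; apply exp_0).
  unfold log_accel; rewrite <- hd.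
  set (L1 := euler_sol_log lam mu t0 y0 y1 s); set (L := euler_sol lam mu t0 y0 y1 s).
  assert (hpos : 0 < (2 - c) * (exp (- w s) * (p s) ^ 2)).
    apply Rmult_lt_0_compat; [lra|]; apply Rmult_lt_0_compat; [lra | now apply pow_lt].
  replace (exp (- w s) * ((lam - mu) * p s + b * (exp (w s) - 1) + (c - 1) * p s ^ 2 - p s ^ 2))
    with ((lam - mu) * (exp (- w s) * p s) + b * (exp (- w s) * exp (w s) - exp (- w s))
          - (2 - c) * (exp (- w s) * p s ^ 2)) by ring.
  rewrite hone, <- hm; nra.
Qed.

(** Relative to the linear equation, [w] has the surplus [b * (exp w - 1 - w) + (c - 1) * p ^ 2],
    positive because [w > 0]. *)
Lemma log_curve_lower (a b c lam mu t0 T : R) (w p : R -> R) :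
  0 < b -> 1 < c -> 0 < t0 -> 0 < lam + mu -> lam - mu = 1 - a -> lam * mu = b ->
  (forall t, t0 <= t < T -> 0 < w t /\ is_derive w t (p t / t) /\
     is_derive p t (log_accel a b c (w t) (p t) / t)) ->
  forall t, t0 < t < T -> euler_sol lam mu t0 (w t0) (p t0) t < w t.
Proof.
intros hb hc ht0 hlm hd hm h t ht.
destruct (euler_sol_init lam mu t0 (w t0) (p t0) ht0 hlm) as [e0 e1].
cut (0 < w t - euler_sol lam mu t0 (w t0) (p t0) t); [lra|].
apply (linear_comparison lam mu t0 T
  (fun t => w t - euler_sol lam mu t0 (w t0) (p t0) t)
  (fun t => p t - euler_sol_log lam mu t0 (w t0) (p t0) t)
  (fun t => log_accel a b c (w t) (p t)
            - ((lam - mu) * euler_sol_log lam mu t0 (w t0) (p t0) t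
               + lam * mu * euler_sol lam mu t0 (w t0) (p t0) t)));
  [exact ht0 | rewrite e0; ring | rewrite e1; ring | | exact ht].
intros s hs; destruct (h s hs) as [hw0 [hw hpd]].
split; [|split].
- eapply is_derive_eq.
  + apply (is_derive_minus (V := R_NormedModule)); [apply hw | apply euler_sol_derive; lra].
  + unfold minus, plus, opp; simpl; field; lra.
- eapply is_derive_eq.
  + apply (is_derive_minus (V := R_NormedModule)); [apply hpd | apply euler_sol_log_derive; lra].
  + unfold minus, plus, opp; simpl; field; lra.
- assert (h1 : b * (1 + w s) < b * exp (w s))
    by (apply Rmult_lt_compat_l; [lra | apply exp_ineq1; lra]).
  assert (h2 : 0 <= (c - 1) * (p s) ^ 2) by (apply Rmult_le_pos; [lra | apply pow2_ge_0]).
  unfold log_accel; rewrite <- hd, <- hm in *; lra.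
Qed.

(* [t * (euler_sol t - C t^lam - D / t)] is nonnegative at [t0] and nondecreasing;
   both facts hinge on the normalisation [max (1, mu)] in [C]. *)
Lemma euler_sol_ge_explicit (lam mu t0 w0 p0 t : R) :
  0 < lam -> 0 < mu -> 0 < t0 -> 0 <= w0 -> 0 <= p0 -> t0 <= t ->
  (mu * w0 + p0) / ((1 + lam) * Rmax 1 mu) * Rpower (t / t0) lam
  + (lam * w0 - p0 / mu) / (1 + lam) * (t0 / t)
    <= euler_sol lam mu t0 w0 p0 t.
Proof.
intros hl hm ht0 hw hp ht.
set (S := mu * w0 + p0); set (M := Rmax 1 mu).
set (al := S / (lam + mu)); set (be := (lam * w0 - p0) / (lam + mu)).
set (C := S / ((1 + lam) * M)); set (D := (lam * w0 - p0 / mu) / (1 + lam)).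
assert (hS : 0 <= S) by (unfold S; nra).
assert (hM : 1 <= M) by apply Rmax_l.
assert (hMcase : (M = 1 /\ mu <= 1) \/ (M = mu /\ 1 <= mu)).
  unfold M, Rmax; destruct (Rle_dec 1 mu); [right | left]; lra.
assert (haC : C <= al).
  unfold C, al; apply Rmult_le_compat_l; [trivial|].
  apply Rinv_le_contravar; [lra|]; destruct hMcase as [[-> h]|[-> h]]; nra.
(* This is the derivative at [t0] of the function [h] below, and [hinit] is about [h t0 / t0]. *)
assert (hsum : 0 <= (1 + lam) * (al - C) + (1 - mu) * be).
  replace ((1 + lam) * (al - C) + (1 - mu) * be) with (w0 + p0 - S / M)
    by (unfold al, be, C, S; field; lra).
  unfold S; destruct hMcase as [[-> h]|[-> h]].
  - replace (w0 + p0 - (mu * w0 + p0) / 1) with ((1 - mu) * w0) by field; nra.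
  - replace (w0 + p0 - (mu * w0 + p0) / mu) with (p0 * ((mu - 1) * / mu)) by (field; lra).
    assert (0 < / mu) by now apply Rinv_0_lt_compat.
    apply Rmult_le_pos; [trivial | apply Rmult_le_pos; lra].
assert (hinit : 0 <= al + be - C - D).
  replace (al + be - C - D) with ((w0 - S / M + p0 / mu) * / (1 + lam))
    by (unfold al, be, C, D, S; field; lra).
  apply Rmult_le_pos; [|apply Rlt_le, Rinv_0_lt_compat; lra].
  unfold S; destruct hMcase as [[-> h]|[-> h]].
  - replace (w0 - (mu * w0 + p0) / 1 + p0 / mu)
      with ((1 - mu) * w0 + p0 * ((1 - mu) * / mu)) by (field; lra).
    assert (0 < / mu) by now apply Rinv_0_lt_compat.
    apply Rplus_le_le_0_compat; repeat apply Rmult_le_pos; lra.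
  - replace (w0 - (mu * w0 + p0) / mu + p0 / mu) with 0 by (field; lra); lra.
pose (h := fun t => t * ((al - C) * Rpower (t / t0) lam + be * Rpower (t / t0) (- mu)) - D * t0).
assert (hd : forall s, t0 <= s -> is_derive h s
   ((1 + lam) * (al - C) * Rpower (s / t0) lam + (1 - mu) * be * Rpower (s / t0) (- mu))).
  intros s hs; unfold h; eapply is_derive_eq.
  - apply (is_derive_minus (V := R_NormedModule)); [|apply (is_derive_const (V := R_NormedModule))].
    eapply (is_derive_mult (fun t : R_AbsRing => t)
      (fun t => (al - C) * Rpower (t / t0) lam + be * Rpower (t / t0) (- mu)) s
      1 ((al - C) * (lam * Rpower (s / t0) lam / s)
         + be * (- mu * Rpower (s / t0) (- mu) / s)));
      [apply (is_derive_id (K := R_AbsRing)) | | intros; apply Rmult_comm].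
    apply (is_derive_plus (V := R_NormedModule));
      apply is_derive_scal; apply is_derive_Rpower_div; lra.
  - unfold minus, plus, opp, mult, one, zero; simpl; field; lra.
assert (hmon : h t0 <= h t).
  apply nondecreasing_of_derive with (fun s =>
   (1 + lam) * (al - C) * Rpower (s / t0) lam + (1 - mu) * be * Rpower (s / t0) (- mu)).
  - trivial.
  - intros s hs; eapply is_derive_continuous, hd; lra.
  - intros s hs; apply hd; lra.
  - intros s hs.
    assert (h1 := Rpower_ge1 (s / t0) lam (ratio_ge1 t0 s ht0 ltac:(lra)) ltac:(lra)).
    assert (h2 := Rpower_neg_le1 (s / t0) mu (ratio_ge1 t0 s ht0 ltac:(lra)) ltac:(lra)).
    assert (h3 := Rpower_pos (s / t0) (- mu)).
    set (X := Rpower (s / t0) lam) in *; set (Y := Rpower (s / t0) (- mu)) in *.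
    (* The [be] term may be negative; since [X >= 1 >= Y], nonnegativity at [t0], that is [hsum],
       propagates to later times. *)
    replace ((1 + lam) * (al - C) * X + (1 - mu) * be * Y)
      with ((1 + lam) * (al - C) * (X - Y) + ((1 + lam) * (al - C) + (1 - mu) * be) * Y) by ring.
    apply Rplus_le_le_0_compat; repeat apply Rmult_le_pos; lra.
assert (h0 : h t0 = (al + be - C - D) * t0).
  unfold h; replace (t0 / t0) with 1 by (field; lra); rewrite !Rpower_1_base; ring.
assert (hpos : 0 <= h t) by (rewrite h0 in hmon; nra).
unfold euler_sol; fold S; fold al be.
cut (0 <= h t * / t).
- unfold h; intros hh.
  replace (t * ((al - C) * Rpower (t / t0) lam + be * Rpower (t / t0) (- mu)) - D * t0)
    with (t * ((al - C) * Rpower (t / t0) lam + be * Rpower (t / t0) (- mu) - D * (t0 / t)))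
    in hh by (field; lra).
  rewrite (Rmult_comm t), Rmult_assoc, Rinv_r, Rmult_1_r in hh by lra; lra.
- apply Rmult_le_pos; [trivial | apply Rlt_le, Rinv_0_lt_compat; lra].
Qed.

(** * The upper critical time *)

(* [K] below is [t^a f' (1 + f)^(-c)] up to a constant factor. *)
Lemma log_curve_power_gap (a b c E t0 T : R) (w p : R -> R) :
  1 < a -> 0 < b -> 1 < c -> 0 < t0 ->
  E = (1 - c) * p t0 * Rpower t0 (- (1 - a)) / (1 - a) ->
  (forall t, t0 <= t < T -> 0 < w t /\ is_derive w t (p t / t) /\
     is_derive p t (log_accel a b c (w t) (p t) / t)) ->
  forall s t, t0 <= s < t -> t < T ->
    1 - E * Rpower t0 (1 - a) + E * Rpower s (1 - a) - exp ((1 - c) * (w s - w t0))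
    < 1 - E * Rpower t0 (1 - a) + E * Rpower t (1 - a) - exp ((1 - c) * (w t - w t0)).
Proof.
intros ha hb hc ht0 hE h s1 t1 hst ht1.
(* In the derivative the power of [t] cancels [(1 - a) * p] and the exponential cancels
   [(c - 1) * p ^ 2]; only the positive source survives. *)
pose (K := fun t => Rpower t (- (1 - a)) * (p t * exp ((1 - c) * (w t - w t0)))).
assert (hKd : forall t, t0 <= t < T -> is_derive K t
   (Rpower t (- (1 - a)) * exp ((1 - c) * (w t - w t0)) * (b * (exp (w t) - 1)) / t)).
  intros t ht; destruct (h t ht) as [_ [hw hp]]; unfold K.
  assert (hdw : Derive (fun x => w x) t = p t / t) by apply is_derive_unique, hw.
  assert (hdp : Derive (fun x => p x) t = log_accel a b c (w t) (p t) / t)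
    by apply is_derive_unique, hp.
  assert (hexw : ex_derive w t) by (eexists; apply hw).
  assert (hexp : ex_derive p t) by (eexists; apply hp).
  eapply is_derive_eq.
  - apply (is_derive_mult (fun t => Rpower t (- (1 - a)))
      (fun t => p t * exp ((1 - c) * (w t - w t0))) t
      (- (1 - a) * Rpower t (- (1 - a)) / t)
      (log_accel a b c (w t) (p t) / t * exp ((1 - c) * (w t - w t0))
       + p t * ((1 - c) * (p t / t) * exp ((1 - c) * (w t - w t0))))).
    + apply is_derive_Rpower; lra.
    + auto_derive; [repeat split; trivial | rewrite hdw, hdp; unfold Rminus; ring].
    + intros; apply Rmult_comm.
  - unfold plus, mult, log_accel; simpl; field; lra.
assert (hK : forall t, t0 < t < T -> K t0 < K t).
  intros t ht; apply increasing_of_derive with (fun t =>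
    Rpower t (- (1 - a)) * exp ((1 - c) * (w t - w t0)) * (b * (exp (w t) - 1)) / t).
  - lra.
  - intros s hs; eapply is_derive_continuous, hKd; lra.
  - intros s hs; apply hKd; lra.
  - intros s hs; destruct (h s ltac:(lra)) as [hw0 _].
    assert (1 < exp (w s)) by (rewrite <- exp_0; apply exp_increasing; lra).
    apply Rdiv_lt_0_compat; [|lra].
    apply Rmult_lt_0_compat; [|apply Rmult_lt_0_compat; lra].
    apply Rmult_lt_0_compat; [apply Rpower_pos | apply exp_pos].
assert (hK0 : K t0 = Rpower t0 (- (1 - a)) * p t0).
  unfold K; rewrite Rminus_diag, Rmult_0_r, exp_0; ring.
(* [E] is calibrated so that the derivative of [gap] is a positive multiple of [K t - K t0]. *)
pose (gap := fun t => 1 - E * Rpower t0 (1 - a) + E * Rpower t (1 - a)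
                      - exp ((1 - c) * (w t - w t0))).
assert (hg : forall t, t0 <= t < T -> is_derive gap t
     ((c - 1) * Rpower t (1 - a) / t * (K t - K t0))).
  intros t ht; destruct (h t ht) as [_ [hw _]]; unfold gap.
  assert (hdw : Derive (fun x => w x) t = p t / t) by apply is_derive_unique, hw.
  assert (hexw : ex_derive w t) by (eexists; apply hw).
  eapply is_derive_eq.
  - apply (is_derive_minus (V := R_NormedModule)
      (fun t => 1 - E * Rpower t0 (1 - a) + E * Rpower t (1 - a))
      (fun t => exp ((1 - c) * (w t - w t0))) t
      (plus zero (E * ((1 - a) * Rpower t (1 - a) / t)))
      ((1 - c) * (p t / t) * exp ((1 - c) * (w t - w t0)))).
    + apply (is_derive_plus (V := R_NormedModule));
        [apply (is_derive_const (V := R_NormedModule))|].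
      apply is_derive_scal, is_derive_Rpower; lra.
    + auto_derive; [trivial | rewrite hdw; unfold Rminus; ring].
  - rewrite hK0; unfold K; subst E.
    assert (hinv : Rpower t (1 - a) * Rpower t (- (1 - a)) = 1)
      by (rewrite <- Rpower_plus, Rplus_opp_r; apply Rpower_O; lra).
    unfold minus, plus, opp, zero; simpl.
    set (X := Rpower t (1 - a)) in *; set (Y := Rpower t (- (1 - a))) in *.
    set (e := exp ((1 - c) * (w t - w t0))).
    replace ((c - 1) * X / t * (Y * (p t * e) - Rpower t0 (- (1 - a)) * p t0))
      with ((c - 1) / t * (X * Y * (p t * e) - X * Rpower t0 (- (1 - a)) * p t0))
      by (field; lra).
    rewrite hinv; field; lra.
apply increasing_of_derive with (f := gap)
  (df := fun t => (c - 1) * Rpower t (1 - a) / t * (K t - K t0)).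
- lra.
- intros t ht; eapply is_derive_continuous, hg; lra.
- intros t ht; apply hg; lra.
- intros t ht; assert (hp := Rpower_pos t (1 - a)); assert (hk := hK t ltac:(lra)).
  apply Rmult_lt_0_compat; [|lra].
  apply Rdiv_lt_0_compat; [apply Rmult_lt_0_compat|]; lra.
Qed.

(** * The stated coefficients in terms of the Euler exponents *)

(** [lam] and [- mu] are the roots of [X ^ 2 = (1 - a) * X + b]; [lam] is positive because
    [tri a b > - bar a]. *)
Lemma tri_spec (a b : R) : 1 < a -> 0 < b ->
  exists lam mu, 0 < lam /\ 0 < mu /\ lam - mu = bar a /\ lam + mu = tri a b /\
    lam * mu = b.
Proof.
intros ha hb; exists ((bar a + tri a b) / 2), ((tri a b - bar a) / 2).
assert (h : tri a b * tri a b = (bar a) * (bar a) + 4 * b).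
  unfold tri, bar; rewrite sqrt_sqrt; [ring|].
  generalize (pow2_ge_0 (1 - a)); lra.
assert (h0 : 0 <= tri a b) by apply sqrt_pos.
assert (hbar : bar a < 0) by (unfold bar; lra).
assert (h1 : - bar a < tri a b) by nra.
repeat split; try lra.
Qed.

(** The data are those of [1 - exp (- w)] at [t0]: [u / (1 + u)] is its value,
    [t0 * v / (1 + u) ^ 2] its logarithmic derivative [exp (- w) * p]. [coefA] carries the decaying
    mode, [coefB] the growing one. *)
Lemma upper_denominator_euler (a b t0 u v lam mu t : R) :
  0 < t0 -> 0 < u -> 0 < t -> 0 < lam -> 0 < mu ->
  lam - mu = bar a -> lam + mu = tri a b ->
  upper_denominator a b t0 u v t
  = 1 - euler_sol lam mu t0 (u / (1 + u)) (t0 * v / (1 + u) ^ 2) t.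
Proof.
intros ht0 hu ht hl hm e1 e2.
unfold upper_denominator, coefA, coefB, euler_sol.
rewrite <- e1, <- e2, !Rpower_div by trivial.
replace ((lam - mu - (lam + mu)) / 2) with (- mu) by field.
replace ((lam - mu + (lam + mu)) / 2) with lam by field.
field; lra.
Qed.

(** By [lam * mu = b], the quotient [(bar a + tri a b) / (2 * b)] is [/ mu], and
    [mu * Rmax (/ mu) 1] is the normalisation [Rmax 1 mu]. *)
Lemma explicit_exponent_euler (a b t0 u v lam mu t : R) :
  0 < t0 -> 0 < u -> 0 < t -> 0 < lam -> 0 < mu ->
  lam - mu = bar a -> lam + mu = tri a b -> lam * mu = b ->
  coefC a b t0 u v * Rpower t ((bar a + tri a b) / 2) + coefD a b t0 u v * / t
  = (mu * ln (1 + u) + t0 * v / (1 + u)) / ((1 + lam) * Rmax 1 mu) * Rpower (t / t0) lam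
    + (lam * ln (1 + u) - t0 * v / (1 + u) / mu) / (1 + lam) * (t0 / t).
Proof.
intros ht0 hu ht hl hm e1 e2 e3.
unfold coefC, coefD.
rewrite <- e1, <- e2, !Rpower_div by trivial.
replace ((lam - mu + (lam + mu)) / 2) with lam by field.
replace ((lam - mu + (lam + mu)) / (2 * b)) with (/ mu) by (rewrite <- e3; field; lra).
assert (hM : Rmax 1 mu = mu * Rmax (/ mu) 1).
  rewrite Rmult_max_distr_l, Rinv_r, Rmult_1_r by lra; trivial.
rewrite hM.
assert (hM1 : 1 <= Rmax (/ mu) 1) by apply Rmax_r.
rewrite <- e3; field; lra.
Qed.

(** The denominator is [1] minus an increasing Euler solution that starts below [1], so its zero is
    unique. The monotonicity is exported because it gives the sign before [tl]. *)
Lemma lower_star_exists (a b t0 u v : R) :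
  1 < a -> 0 < b -> 0 < t0 -> 0 < u -> 0 < v ->
  exists tl, t0 < tl /\ is_lower_star a b t0 u v tl /\
    forall s t, t0 <= s < t ->
      upper_denominator a b t0 u v t < upper_denominator a b t0 u v s.
Proof.
intros ha hb ht0 hu hv.
destruct (tri_spec a b ha hb) as [lam [mu [hl [hm [e1 [e2 e3]]]]]].
set (y0 := u / (1 + u)); set (y1 := t0 * v / (1 + u) ^ 2).
assert (hy1 : 0 < y1).
  apply Rdiv_lt_0_compat; [now apply Rmult_lt_0_compat | apply pow_lt; lra].
assert (hy0 : 0 < y0 < 1).
  unfold y0; split; [apply Rdiv_lt_0_compat; lra|].
  apply Rmult_lt_reg_r with (1 + u); [lra|].
  unfold Rdiv; rewrite Rmult_assoc, Rinv_l by lra; lra.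
assert (hE : forall t, t0 <= t ->
    upper_denominator a b t0 u v t = 1 - euler_sol lam mu t0 y0 y1 t).
  intros t ht; apply upper_denominator_euler; trivial; lra.
assert (hmon : forall s t, t0 <= s < t ->
    upper_denominator a b t0 u v t < upper_denominator a b t0 u v s).
  intros s t hst; rewrite !hE by lra.
  assert (hi := euler_sol_increasing lam mu t0 y0 y1 s t hl hm ht0 ltac:(lra) hy1 hst).
  lra.
destruct (euler_sol_reaches_1 lam mu t0 y0 y1 hl hm ht0 hy0 hy1) as [tl [htl e]].
exists tl; split; [trivial|]; split; [|trivial].
assert (h0 : upper_denominator a b t0 u v tl = 0) by (rewrite hE by lra; lra).
split; [now split|]; intros t [ht hz].
apply Rnot_lt_le; intros hlt; specialize (hmon t tl ltac:(lra)); lra.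
Qed.

(** Carries a gap that is uniform before the blow-up time over to that time, where only the explicit
    functions still make sense. *)
Lemma continuous_ge_at_left (f : R -> R) (s T d : R) :
  s < T -> continuous f T -> (forall t, s < t < T -> d <= f t) -> d <= f T.
Proof.
intros hs hc h; apply Rnot_lt_le; intros hlt.
destruct (proj1 (continuous_eps f T) hc (d - f T) ltac:(lra)) as [e [he hd]].
pose (k := Rmin (e / 2) ((T - s) / 2)).
assert (0 < k) by (apply Rmin_glb_lt; lra).
assert (k <= e / 2) by apply Rmin_l; assert (k <= (T - s) / 2) by apply Rmin_r.
specialize (hd (T - k)); specialize (h (T - k) ltac:(lra)).
replace (T - k - T) with (- k) in hd by ring.
rewrite Rabs_Ropp, Rabs_pos_eq in hd by lra.
specialize (hd ltac:(lra)); apply Rabs_def2 in hd; lra.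
Qed.

Lemma Rpower_decr_reg (x y k : R) : 0 < x -> 0 < y -> k < 0 ->
  Rpower x k < Rpower y k -> y < x.
Proof.
intros hx hy hk h; apply exp_lt_inv in h.
apply ln_lt_inv; trivial; nra.
Qed.

Theorem theorem1p1 (a b c t0 u v : R)
  (ha : 1 < a) (hb : 0 < b) (hc : 1 < c < 3 / 2) (ht0 : 0 < t0)
  (hu : 0 < u) (hv : 0 < v) :
  exists tl : R,
    (* (1) *)
    is_lower_star a b t0 u v tl /\ 0 <= tl /\ t0 < tl /\
    exists (tm : Rbar) (f f0 : R -> R),
      (* (2) *)
      Rbar_le tl tm /\
      is_solution a b c t0 u v tm f f0 /\
      (forall g g0 : R -> R, is_solution a b c t0 u v tm g g0 ->
         forall t, Ico t0 tm t -> g t = f t) /\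
      tends_to_pinfty_at f tm /\
      tends_to_pinfty_at f0 tm /\
      (* (3) *)
      (forall t, t0 < t -> Rbar_lt t tm ->
         exp (coefC a b t0 u v * Rpower t ((bar a + tri a b) / 2)
              + coefD a b t0 u v * / t) < 1 + f t) /\
      (forall t, t0 < t < tl ->
         1 + f t < / upper_denominator a b t0 u v t) /\
      (bar a * (1 + u) / (bar c * t0) < v ->
         (* (4) *)
         exists tu : R,
           is_upper_star a c t0 u v tu /\ t0 < tl < tu /\
           (* (5) *)
           exists T : R,
             tm = Finite T /\ tl <= T < tu /\
             is_solution a b c t0 u v T f f0 /\
             tends_to_pinfty_at f T /\
             tends_to_pinfty_at f0 T /\
             (* (6) *)
             (forall t, t0 < t < T ->
                (1 + u) * Rpower (1 - coefE a c t0 u v * Rpower t0 (bar a)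
                                  + coefE a c t0 u v * Rpower t (bar a))
                            (1 / bar c) < 1 + f t)).
Proof.
destruct (lower_star_exists a b t0 u v ha hb ht0 hu hv) as [tl [htl [hstar hdecr]]].
destruct (tri_spec a b ha hb) as [lam [mu [hl [hm [e1 [e2 e3]]]]]].
assert (hw0 : 0 < ln (1 + u)) by (rewrite <- ln_1; apply ln_increasing; lra).
assert (hp0 : 0 < t0 * v / (1 + u))
  by (apply Rdiv_lt_0_compat; [apply Rmult_lt_0_compat |]; lra).
destruct (log_solution a b c t0 (ln (1 + u)) (t0 * v / (1 + u)) ha hb hc ht0 hw0 hp0)
  as [tm [eps [w [p [htm [heps [ew [ep [hwp [hblow huniq]]]]]]]]]].
exists tl; split; [exact hstar|]; split; [lra|]; split; [exact htl|].
(* The end time is finite, as a supremum of bounded hitting times; the same [tm] serves as [T] in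
   the last clauses. *)
exists (Finite tm), (fun t => exp (w t) - 1), (fun t => exp (w t) * p t / t).
assert (hupper : forall t, t0 < t < tm -> upper_denominator a b t0 u v t < exp (- w t)).
  intros t ht.
  assert (h := log_curve_upper a b c lam mu t0 tm w p ltac:(lra) ht0 ltac:(lra) e1 e3).
  specialize (h ltac:(intros s hs; destruct (hwp s hs) as [_ [h1 h2]];
                      split; [lra | exact h2]) t ht).
  rewrite ew, ep, (exp_Ropp (ln (1 + u))), exp_ln in h by lra.
  rewrite (upper_denominator_euler a b t0 u v lam mu) by (trivial; lra).
  replace (1 - / (1 + u)) with (u / (1 + u)) in h by (field; lra).
  replace (/ (1 + u) * (t0 * v / (1 + u))) with (t0 * v / (1 + u) ^ 2) in h by (field; lra).
  lra.
assert (hwpos : forall t, t0 <= t < tm -> 0 < w t /\ is_derive w t (p t / t) /\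
     is_derive p t (log_accel a b c (w t) (p t) / t)).
  intros t ht; destruct (hwp t ht) as [h1 [_ h2]]; split; [lra | exact h2].
assert (hle : tl <= tm).
  (* If [tm < tl], the decreasing denominator stays above its positive value [d] at [tm], so
     [exp (- w) > d] up to [tm], against the divergence of [w]. *)
  apply Rnot_lt_le; intros hlt.
  pose (d := upper_denominator a b t0 u v tm).
  assert (hd : 0 < d) by (unfold d; rewrite <- (proj2 (proj1 hstar)); apply hdecr; lra).
  destruct (hblow (- ln d)) as [t1 [ht1 hbig]].
  pose (t := Rmax ((t0 + tm) / 2) ((t1 + tm) / 2)).
  assert ((t0 + tm) / 2 <= t) by apply Rmax_l; assert ((t1 + tm) / 2 <= t) by apply Rmax_r.
  assert (t < tm) by (apply Rmax_lub_lt; lra).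
  specialize (hbig t ltac:(lra)); assert (hup := hupper t ltac:(lra)).
  assert (hdt := hdecr t tm ltac:(lra)); fold d in hdt.
  assert (hexp : exp (- w t) < exp (ln d)) by (apply exp_increasing; lra).
  rewrite exp_ln in hexp by trivial; lra.
assert (hsol : is_solution a b c t0 u v tm (fun t => exp (w t) - 1)
                 (fun t => exp (w t) * p t / t)).
  apply solution_of_log_curve; trivial.
  intros t ht; apply hwp, ht.
assert (hlim : forall M, exists e, 0 < e /\
          forall t, Rabs (t - tm) < e -> t < tm -> t0 <= t /\ M < exp (w t)).
  intros M; destruct (hblow (Rmax 0 M)) as [t1 [ht1 hbig]].
  exists (Rmin (tm - t0) (tm - t1)); split; [apply Rmin_glb_lt; lra|].
  intros t ht hlt.
  assert (h1 := Rlt_le_trans _ _ _ ht (Rmin_l _ _)).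
  assert (h2 := Rlt_le_trans _ _ _ ht (Rmin_r _ _)).
  apply Rabs_def2 in h1; apply Rabs_def2 in h2; split; [lra|].
  specialize (hbig t ltac:(lra)); assert (M <= Rmax 0 M) by apply Rmax_r.
  generalize (exp_ineq1_le (w t)); lra.
assert (hlimf : tends_to_pinfty_at (fun t => exp (w t) - 1) tm).
  intros P [M hM]; destruct (hlim (M + 1)) as [e [he h]].
  exists (mkposreal e he); intros t ht hlt; apply hM; simpl.
  destruct (h t ht hlt); simpl; lra.
assert (hlimf0 : tends_to_pinfty_at (fun t => exp (w t) * p t / t) tm).
  (* The threshold reflects [exp w * p / t >= exp w * eps / tm]. *)
  intros P [M hM]; destruct (hlim (Rmax 0 M * tm / eps)) as [e [he h]].
  exists (mkposreal e he); intros t ht hlt; apply hM; simpl.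
  destruct (h t ht hlt) as [h1 h2]; simpl in hlt.
  destruct (hwp t ltac:(lra)) as [_ [h3 _]].
  apply Rmult_lt_reg_r with t; [lra|].
  replace (exp (w t) * p t / t * t) with (exp (w t) * p t) by (field; lra).
  apply (Rmult_lt_compat_r eps) in h2; [|trivial].
  replace (Rmax 0 M * tm / eps * eps) with (Rmax 0 M * tm) in h2 by (field; lra).
  assert (0 <= Rmax 0 M) by apply Rmax_l; assert (M <= Rmax 0 M) by apply Rmax_r.
  assert (hep := exp_pos (w t)).
  assert (M * t <= Rmax 0 M * tm).
    apply Rle_trans with (Rmax 0 M * t);
      [apply Rmult_le_compat_r | apply Rmult_le_compat_l]; lra.
  assert (exp (w t) * eps <= exp (w t) * p t) by (apply Rmult_le_compat_l; lra).
  lra.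
split; [exact hle|]; split; [exact hsol|]; split; [|split; [exact hlimf|]];
  [|split; [exact hlimf0|]; split; [|split]].
- intros g g0 hg t [ht1 ht2]; simpl in ht2.
  destruct (log_curve_of_solution a b c t0 u v tm g g0 ht0 hu hg) as [hpos hcurve].
  assert (hinit : g t0 = u /\ g0 t0 = v) by (destruct hg as [? [_ [_ h]]]; exact h).
  assert (heq := huniq _ _ hcurve); simpl in heq.
  rewrite (Rmax_right t0 t0), (proj1 hinit), (proj2 hinit) in heq by lra.
  specialize (heq eq_refl eq_refl t ltac:(lra)).
  rewrite (Rmax_right t0 t) in heq by lra.
  rewrite <- heq, exp_ln by (apply hpos; lra); ring.
- intros t ht hlt; simpl in hlt.
  replace (1 + (exp (w t) - 1)) with (exp (w t)) by ring.
  apply exp_increasing.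
  rewrite (explicit_exponent_euler a b t0 u v lam mu) by (trivial; lra).
  eapply Rle_lt_trans; [apply euler_sol_ge_explicit; trivial; lra|].
  rewrite <- ew, <- ep.
  apply (log_curve_lower a b c lam mu t0 tm w p); trivial; lra.
- intros t ht.
  replace (1 + (exp (w t) - 1)) with (exp (w t)) by ring.
  assert (hup := hupper t ltac:(lra)).
  assert (hden : 0 < upper_denominator a b t0 u v t).
    rewrite <- (proj2 (proj1 hstar)); apply hdecr; lra.
  replace (exp (w t)) with (/ exp (- w t)) by (rewrite exp_Ropp; apply Rinv_inv).
  apply Rinv_lt_contravar; [|trivial].
  apply Rmult_lt_0_compat; [trivial | apply exp_pos].
- intros hcond.
  set (E := coefE a c t0 u v).
  assert (hE : E = (1 - c) * p t0 * Rpower t0 (- (1 - a)) / (1 - a)).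
    unfold E, coefE, bar; rewrite ep.
    replace (1 - (1 - a)) with (1 + - (1 - a)) by ring.
    rewrite Rpower_plus, Rpower_1 by trivial; field; lra.
  assert (hinv0 : Rpower t0 (1 - a) * Rpower t0 (- (1 - a)) = 1)
    by (rewrite <- Rpower_plus, Rplus_opp_r; apply Rpower_O; lra).
  assert (hX := Rpower_pos t0 (1 - a)); assert (hY := Rpower_pos t0 (- (1 - a))).
  assert (hEpos : 0 < E).
    rewrite hE, ep.
    replace ((1 - c) * (t0 * v / (1 + u)) * Rpower t0 (- (1 - a)) / (1 - a))
      with ((c - 1) * (t0 * v / (1 + u)) * Rpower t0 (- (1 - a)) / (a - 1)) by (field; lra).
    apply Rdiv_lt_0_compat; [|lra].
    apply Rmult_lt_0_compat; [apply Rmult_lt_0_compat; lra | trivial].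
  (* The lower bound on [v], rewritten; as [E > 0], it is exactly the condition for the upper
     critical time to be defined. *)
  assert (hEX : 1 < E * Rpower t0 (1 - a)).
    assert (h : E * Rpower t0 (1 - a) = (c - 1) * t0 / ((a - 1) * (1 + u)) * v).
      rewrite hE, ep.
      replace ((1 - c) * (t0 * v / (1 + u)) * Rpower t0 (- (1 - a)) / (1 - a)
               * Rpower t0 (1 - a))
        with ((1 - c) * (t0 * v / (1 + u)) / (1 - a)
               * (Rpower t0 (1 - a) * Rpower t0 (- (1 - a)))) by (field; lra).
      rewrite hinv0; field; lra.
    rewrite h.
    apply Rle_lt_trans with
      ((c - 1) * t0 / ((a - 1) * (1 + u)) * (bar a * (1 + u) / (bar c * t0))).
      apply Req_le; unfold bar; field; lra.
    apply Rmult_lt_compat_l; [|trivial].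
    apply Rdiv_lt_0_compat; apply Rmult_lt_0_compat; lra.
  assert (hgap := log_curve_power_gap a b c E t0 tm w p ha hb ltac:(lra) ht0 hE hwpos).
  pose (base := fun t => 1 - E * Rpower t0 (1 - a) + E * Rpower t (1 - a)).
  assert (hbase : forall t, t0 < t < tm -> exp ((1 - c) * (w t - ln (1 + u))) < base t).
    intros t ht; specialize (hgap t0 t ltac:(lra) (proj2 ht)).
    rewrite <- ew; rewrite Rminus_diag, Rmult_0_r, exp_0 in hgap.
    unfold base; lra.
  (* Passing [base t > 0] to the limit would only give [tm <= tu]. The gap increases, so [base]
     stays above its midpoint value [d], whence [base tm >= d > 0]. *)
  assert (hbtm : 0 < base tm).
    pose (t1 := (t0 + tm) / 2).
    pose (d := base t1 - exp ((1 - c) * (w t1 - w t0))).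
    assert (hd : 0 < d).
      assert (h := hbase t1 ltac:(unfold t1; lra)); rewrite <- ew in h; unfold d; lra.
    apply Rlt_le_trans with d; [trivial|].
    apply continuous_ge_at_left with t1.
    - unfold t1; lra.
    - apply (continuous_plus (V := R_NormedModule)); [apply continuous_const|].
      apply (continuous_mult (K := R_AbsRing)); [apply continuous_const|].
      eapply is_derive_continuous, is_derive_Rpower; lra.
    - intros t ht.
      assert (h := hgap t1 t ltac:(unfold t1 in *; lra) (proj2 ht)).
      assert (hx := exp_pos ((1 - c) * (w t - w t0))); unfold d, base; lra.
  pose (X := Rpower t0 (1 - a) - / E).
  assert (hXpos : / E < Rpower t0 (1 - a)).
    apply Rmult_lt_reg_l with E; [trivial|]; rewrite Rinv_r; lra.
  pose (tu := Rpower X (1 / (1 - a))).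
  assert (htuX : Rpower tu (1 - a) = X).
    unfold tu; rewrite Rpower_mult.
    replace (1 / (1 - a) * (1 - a)) with 1 by (field; lra).
    apply Rpower_1; unfold X; lra.
  assert (hlt : tm < tu).
    (* [base] vanishes at [tu] and decreases, the exponent [1 - a] being negative, so its positivity
       at [tm] places [tm] before [tu]. *)
    apply (Rpower_decr_reg tu tm (1 - a)); [apply Rpower_pos | lra | lra|].
    rewrite htuX; unfold X; apply Rmult_lt_reg_l with E; [trivial|].
    rewrite Rmult_minus_distr_l, Rinv_r by lra; unfold base in hbtm; lra.
  exists tu; split; [split; [exact hXpos | reflexivity]|].
  split; [lra|].
  exists tm; split; [reflexivity|]; split; [lra|].
  split; [exact hsol|]; split; [exact hlimf|]; split; [exact hlimf0|].
  intros t ht.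
  assert (h := hbase t ht).
  replace (1 + (exp (w t) - 1)) with (exp (w t)) by ring.
  replace (exp (w t)) with ((1 + u) * exp (w t - ln (1 + u))) by
    (unfold Rminus; rewrite exp_plus, exp_Ropp, exp_ln by lra; field; lra).
  apply Rmult_lt_compat_l; [lra|].
  apply exp_increasing.
  (* The logarithm bounds [(1 - c) * (w t - ln (1 + u))] from above; dividing by [1 - c < 0] turns
     this into the lower bound. *)
  apply ln_increasing in h; [|apply exp_pos]; rewrite ln_exp in h.
  change (1 - E * Rpower t0 (bar a) + E * Rpower t (bar a)) with (base t).
  unfold bar.
  apply Rmult_lt_reg_l with (c - 1); [lra|].
  replace ((c - 1) * (1 / (1 - c) * ln (base t))) with (- ln (base t)) by (field; lra).
  lra.
Qed.
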